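(* Let $\mathsf{C}$ be a strict braided monoidal category. The category $\mathtt{s}\mathsf{HBr}$ of $\mathtt{s}$-Hopf braces in $\mathsf{C}$ and the category $\mathsf{BT}$ of brace triples in $\mathsf{C}$ are isomorphic.
   Context: $\mathsf{C}$ is a strict braided monoidal category with tensor product $\otimes$, unit object $K$ and braiding $c$ (not assumed symmetric). For an object $P$ and a morphism $f$, $P\otimes f$ means $id_P\otimes f$ and $f\otimes P$ means $f\otimes id_P$. Algebras, coalgebras, bialgebras and Hopf algebras are internal to $\mathsf{C}$; the tensor product of coalgebras $D,E$ has coproduct $(D\otimes c_{D,E}\otimes E)\circ(\delta_D\otimes\delta_E)$ and counit $\varepsilon_D\otimes\varepsilon_E$, and the tensor product of algebras $A,B$ has product $(\mu_A\otimes\mu_B)\circ(A\otimes c_{B,A}\otimes B)$. A Hopf algebra $H=(H,\eta_H,\mu_H,\varepsilon_H,\delta_H,\lambda_H)$ is a bialgebra with a morphism (antipode) $\lambda_H$ such that $\mu_H\circ(H\otimes\lambda_H)\circ\delta_H=\eta_H\circ\varepsilon_H=\mu_H\circ(\lambda_H\otimes H)\circ\delta_H$. Hopf algebra morphisms are morphisms that are both algebra and coalgebra morphisms. Hopf brace: a coalgebra $(H,\varepsilon_H,\delta_H)$ with two Hopf algebra structures $H_1=(H,\eta_H^1,\mu_H^1,\varepsilon_H,\delta_H,\lambda_H^1)$ and $H_2=(H,\eta_H^2,\mu_H^2,\varepsilon_H,\delta_H,\lambda_H^2)$ in $\mathsf{C}$ such that $\mu_H^2\circ(H\otimes\mu_H^1)=\mu_H^1\circ(\mu_H^2\otimes\Gamma_{H_1})\circ(H\otimes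 c_{H,H}\otimes H)\circ(\delta_H\otimes H\otimes H)$, where $\Gamma_{H_1}=\mu_H^1\circ(\lambda_H^1\otimes\mu_H^2)\circ(\delta_H\otimes H)$. It is denoted $\mathbb{H}=(H_1,H_2)$. A morphism of Hopf braces $\mathbb{H}\to\mathbb{B}$ is a morphism $f:H\to B$ in $\mathsf{C}$ such that $f:H_1\to B_1$ and $f:H_2\to B_2$ are Hopf algebra morphisms. $\mathtt{s}$-Hopf brace: a Hopf brace $\mathbb{H}$ such that (i) $(\Gamma_{H_1}\otimes H)\circ(H\otimes c_{H,H})\circ(\delta_H\otimes H)=(\Gamma_{H_1}\otimes H)\circ(H\otimes c_{H,H})\circ((c_{H,H}\circ\delta_H)\otimes H)$; (ii) $\lambda_H^1$ and $\lambda_H^2$ are isomorphisms in $\mathsf{C}$, and (ii.1) $\mu_H^1\circ(H\otimes\Gamma_{H_1})\circ((\delta_H\circ\lambda_H^2)\otimes H)=\mu_H^1\circ(H\otimes\Gamma_{H_1})\circ(((\lambda_H^2\otimes\lambda_H^2)\circ\delta_H)\otimes H)$, (ii.2) $\Gamma_{H_1}\circ(\lambda_H^2\otimes H)\circ\delta_H=(\lambda_H^1)^{-1}\circ\lambda_H^2$. $\mathtt{s}\mathsf{HBr}$ is the full subcategory of the category of Hopf braces whose objects are the $\mathtt{s}$-Hopf braces. Brace triple: $(H,\gamma_H,T_H)$ with $H=(H,\eta_H,\mu_H,\varepsilon_H,\delta_H,\lambda_H)$ a Hopf algebra in $\mathsf{C}$ with $\lambda_H$ an isomorphism, and morphisms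 $\gamma_H:H\otimes H\to H$, $T_H:H\to H$ such that (i) $(\gamma_H\otimes H)\circ(H\otimes c_{H,H})\circ(\delta_H\otimes H)=(\gamma_H\otimes H)\circ(H\otimes c_{H,H})\circ((c_{H,H}\circ\delta_H)\otimes H)$; (ii) $\gamma_H$ is a coalgebra morphism; (iii) $\gamma_H\circ(H\otimes\mu_H)=\mu_H\circ(\gamma_H\otimes\gamma_H)\circ(H\otimes c_{H,H}\otimes H)\circ(\delta_H\otimes H\otimes H)$; (iv) $\gamma_H\circ(H\otimes\gamma_H)=\gamma_H\circ((\mu_H\circ(H\otimes\gamma_H)\circ(\delta_H\otimes H))\otimes H)$; (v) $\gamma_H\circ(\eta_H\otimes H)=id_H$; (vi) $T_H$ is an isomorphism with (vi.1) $\delta_H\circ T_H=c_{H,H}\circ(T_H\otimes T_H)\circ\delta_H$, (vi.2) $\varepsilon_H\circ T_H=\varepsilon_H$, (vi.3) $\mu_H\circ(H\otimes\gamma_H)\circ((\delta_H\circ T_H)\otimes H)=\mu_H\circ(H\otimes\gamma_H)\circ(((T_H\otimes T_H)\circ\delta_H)\otimes H)$, (vi.4) $\gamma_H\circ(H\otimes T_H)\circ\delta_H=\lambda_H$, (vi.5) $\gamma_H\circ(T_H\otimes H)\circ\delta_H=\lambda_H^{-1}\circ T_H$. A morphism of brace triples $(H,\gamma_H,T_H)\to(B,\gamma_B,T_B)$ is a Hopf algebra morphism $f:H\to B$ with $f\circ\gamma_H=\gamma_B\circ(f\otimes f)$. $\mathsf{BT}$ is the resulting category. *)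

(* Defs.v *)
From Stdlib Require Import ProofIrrelevance.
From mathcomp Require Import ssreflect ssrfun ssrbool.

Set Implicit Arguments.
Unset Strict Implicit.
Unset Printing Implicit Defensive.

Declare Scope cat_scope.
Delimit Scope cat_scope with cat.
Local Open Scope cat_scope.

Reserved Notation "g ∘ f" (at level 50, left associativity).
Reserved Notation "A ⊗ B" (at level 40, left associativity).
Reserved Notation "f ⊠ g" (at level 40, left associativity).
Reserved Notation "A ◁ f" (at level 40, left associativity).
Reserved Notation "f ▷ A" (at level 40, left associativity).

Record category := Category {
  ob :> Type;
  hom : ob -> ob -> Type;
  idm : forall a, hom a a;
  comp : forall a b c, hom b c -> hom a b -> hom a c;
  comp1m : forall a b (f : hom a b), comp (idm b) f = f;
  compm1 : forall a b (f : hom a b), comp f (idm a) = f;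
  compA : forall a b c d (h : hom c d) (g : hom b c) (f : hom a b),
    comp h (comp g f) = comp (comp h g) f
}.
Arguments hom {c0} a b : rename.
Arguments idm {c0} a : rename.
Arguments comp {c0 a b c} g f : rename.
Notation "g ∘ f" := (comp g f) : cat_scope.

Definition is_inverse (C : category) (a b : C) (f : hom a b) (g : hom b a) :=
  g ∘ f = idm a /\ f ∘ g = idm b.

Definition is_iso (C : category) (a b : C) (f : hom a b) :=
  exists g : hom b a, is_inverse f g.

Record functor (C D : category) := Functor {
  fob :> C -> D;
  fmor : forall a b, hom a b -> hom (fob a) (fob b);
  fmor_id : forall a, fmor (idm a) = idm (fob a);
  fmor_comp : forall a b c (g : hom b c) (f : hom a b),
    fmor (g ∘ f) = fmor g ∘ fmor f
}.

Definition functor_id (C : category) : functor C C :=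
  @Functor C C (fun a => a) (fun _ _ f => f) (fun _ => erefl)
    (fun _ _ _ _ _ => erefl).

Definition functor_comp (C D E : category)
    (G : functor D E) (F : functor C D) : functor C E.
Proof.
refine (@Functor C E (fun a => G (F a)) (fun _ _ f => fmor G (fmor F f)) _ _).
- by move=> a; rewrite !fmor_id.
- by move=> a b c g f; rewrite !fmor_comp.
Defined.

Definition isomorphic_categories (C D : category) : Prop :=
  exists (F : functor C D) (G : functor D C),
    functor_comp G F = functor_id C /\ functor_comp F G = functor_id D.

Definition full_subcategory (C : category) (P : C -> Prop) : category :=
  @Category {a : C | P a} (fun a b => hom (sval a) (sval b))
    (fun a => idm (sval a)) (fun _ _ _ g f => g ∘ f)
    (fun _ _ f => comp1m f) (fun _ _ f => compm1 f)
    (fun _ _ _ _ h g f => compA h g f).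

Definition eq_hom (C : category) (a b : C) (e : a = b) : hom a b :=
  match e with erefl => idm a end.

(* A strict monoidal category has associativity and unit laws that are
   equalities, both on objects and on morphisms.  Two equal objects are not
   convertible in general, so the equalities on morphisms are stated up to the
   retyped identities [eq_hom], which play the role of the associativity and
   unit constraints.  The pentagon and triangle identities only involve such
   retyped identities, hence hold by uniqueness of equality proofs. *)
Record strict_monoidal := StrictMonoidal {
  sm_cat :> category;
  tens : sm_cat -> sm_cat -> sm_cat;
  tunit : sm_cat;
  tensm : forall a b a' b' : sm_cat,
    hom a b -> hom a' b' -> hom (tens a a') (tens b b');
  tensm_id : forall a b, tensm (idm a) (idm b) = idm (tens a b);
  tensm_comp : forall a b c a' b' c' (g : hom b c) (f : hom a b)
      (g' : hom b' c') (f' : hom a' b'),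
    tensm (g ∘ f) (g' ∘ f') = tensm g g' ∘ tensm f f';
  tensA : forall a b c, tens (tens a b) c = tens a (tens b c);
  tens1o : forall a, tens tunit a = a;
  tenso1 : forall a, tens a tunit = a;
  tensmA : forall a b a' b' a'' b''
      (f : hom a b) (f' : hom a' b') (f'' : hom a'' b''),
    eq_hom (tensA b b' b'') ∘ tensm (tensm f f') f'' =
    tensm f (tensm f' f'') ∘ eq_hom (tensA a a' a'');
  tens1m : forall a b (f : hom a b),
    eq_hom (tens1o b) ∘ tensm (idm tunit) f = f ∘ eq_hom (tens1o a);
  tensm1 : forall a b (f : hom a b),
    eq_hom (tenso1 b) ∘ tensm f (idm tunit) = f ∘ eq_hom (tenso1 a)
}.
Arguments tens {s} a b.
Arguments tunit {s}.
Arguments tensm {s a b a' b'} f g : rename.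
Arguments tensA {s} a b c.
Arguments tens1o {s} a.
Arguments tenso1 {s} a.

Notation "A ⊗ B" := (tens A B) : cat_scope.
Notation "f ⊠ g" := (tensm f g) : cat_scope.
Notation "A ◁ f" := (tensm (idm A) f) : cat_scope.
Notation "f ▷ A" := (tensm f (idm A)) : cat_scope.

Section Constraints.
Variable C : strict_monoidal.
Implicit Types a b c : C.

Definition asc a b c : hom ((a ⊗ b) ⊗ c) (a ⊗ (b ⊗ c)) := eq_hom (tensA a b c).
Definition asc' a b c : hom (a ⊗ (b ⊗ c)) ((a ⊗ b) ⊗ c) :=
  eq_hom (esym (tensA a b c)).
Definition lun a : hom (tunit ⊗ a) a := eq_hom (tens1o a).
Definition lun' a : hom a (tunit ⊗ a) := eq_hom (esym (tens1o a)).
Definition run a : hom (a ⊗ tunit) a := eq_hom (tenso1 a).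
End Constraints.
Arguments asc {C} a b c.
Arguments asc' {C} a b c.
Arguments lun {C} a.
Arguments lun' {C} a.
Arguments run {C} a.

(* [braid_tensr] and [braid_tensl] are the two hexagons, which for identity
   constraints read c_{a,b⊗d} = (b ⊗ c_{a,d}) ∘ (c_{a,b} ⊗ d) and
   c_{a⊗b,d} = (c_{a,d} ⊗ b) ∘ (a ⊗ c_{b,d}). *)
Record strict_braided := StrictBraided {
  sb_mon :> strict_monoidal;
  braid : forall a b : sb_mon, hom (a ⊗ b) (b ⊗ a);
  braid_iso : forall a b, is_iso (braid a b);
  braid_nat : forall (a b a' b' : sb_mon) (f : hom a b) (g : hom a' b'),
    braid b b' ∘ (f ⊠ g) = (g ⊠ f) ∘ braid a a';
  braid_tensr : forall a b d : sb_mon,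
    asc b d a ∘ braid a (b ⊗ d) ∘ asc a b d =
    (b ◁ braid a d) ∘ asc b a d ∘ (braid a b ▷ d);
  braid_tensl : forall a b d : sb_mon,
    asc' d a b ∘ braid (a ⊗ b) d ∘ asc' a b d =
    (braid a d ▷ b) ∘ asc' a d b ∘ (a ◁ braid b d)
}.
Arguments braid {s} a b.

Section Hopf.
Variable C : strict_braided.
Implicit Types A B D E H : C.
Notation K := (@tunit C).

(* The morphism a ⊗ c_{b,b'} ⊗ d. *)
Definition mid_braid (a b b' d : C) :
    hom ((a ⊗ b) ⊗ (b' ⊗ d)) ((a ⊗ b') ⊗ (b ⊗ d)) :=
  asc' a b' (b ⊗ d)
  ∘ (a ◁ (asc b' b d ∘ (braid b b' ▷ d) ∘ asc' b b' d))
  ∘ asc a b (b' ⊗ d).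

Definition is_algebra A (eta : hom K A) (mu : hom (A ⊗ A) A) : Prop :=
  [/\ mu ∘ (A ◁ eta) = run A,
      mu ∘ (eta ▷ A) = lun A
    & mu ∘ (A ◁ mu) ∘ asc A A A = mu ∘ (mu ▷ A)].

Definition is_coalgebra D (eps : hom D K) (delta : hom D (D ⊗ D)) : Prop :=
  [/\ run D ∘ (D ◁ eps) ∘ delta = idm D,
      lun D ∘ (eps ▷ D) ∘ delta = idm D
    & asc D D D ∘ (delta ▷ D) ∘ delta = (D ◁ delta) ∘ delta].

Definition is_alg_mor A B (etaA : hom K A) (muA : hom (A ⊗ A) A)
    (etaB : hom K B) (muB : hom (B ⊗ B) B) (f : hom A B) : Prop :=
  f ∘ etaA = etaB /\ f ∘ muA = muB ∘ (f ⊠ f).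

Definition is_coalg_mor D E (epsD : hom D K) (deltaD : hom D (D ⊗ D))
    (epsE : hom E K) (deltaE : hom E (E ⊗ E)) (f : hom D E) : Prop :=
  epsE ∘ f = epsD /\ deltaE ∘ f = (f ⊠ f) ∘ deltaD.

Definition tens_eta A B (etaA : hom K A) (etaB : hom K B) : hom K (A ⊗ B) :=
  (etaA ⊠ etaB) ∘ lun' K.
Definition tens_mu A B (muA : hom (A ⊗ A) A) (muB : hom (B ⊗ B) B) :
    hom ((A ⊗ B) ⊗ (A ⊗ B)) (A ⊗ B) :=
  (muA ⊠ muB) ∘ mid_braid A B A B.
Definition tens_eps D E (epsD : hom D K) (epsE : hom E K) : hom (D ⊗ E) K :=
  lun K ∘ (epsD ⊠ epsE).
Definition tens_delta D E (deltaD : hom D (D ⊗ D)) (deltaE : hom E (E ⊗ E)) :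
    hom (D ⊗ E) ((D ⊗ E) ⊗ (D ⊗ E)) :=
  mid_braid D D E E ∘ (deltaD ⊠ deltaE).

(* The counit and the coproduct are algebra morphisms; the unit object is an
   algebra with unit id_K and product K ⊗ K = K. *)
Definition is_bialgebra H (eta : hom K H) (mu : hom (H ⊗ H) H)
    (eps : hom H K) (delta : hom H (H ⊗ H)) : Prop :=
  [/\ is_algebra eta mu, is_coalgebra eps delta,
      is_alg_mor eta mu (idm K) (lun K) eps
    & is_alg_mor eta mu (tens_eta eta eta) (tens_mu mu mu) delta].

Definition is_hopf H (eta : hom K H) (mu : hom (H ⊗ H) H)
    (eps : hom H K) (delta : hom H (H ⊗ H)) (lam : hom H H) : Prop :=
  [/\ is_bialgebra eta mu eps delta,
      mu ∘ (H ◁ lam) ∘ delta = eta ∘ eps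
    & mu ∘ (lam ▷ H) ∘ delta = eta ∘ eps].

(* A Hopf algebra structure whose underlying coalgebra is (H, eps, delta). *)
Record hopf_on H (eps : hom H K) (delta : hom H (H ⊗ H)) := HopfOn {
  eta : hom K H;
  mu : hom (H ⊗ H) H;
  lam : hom H H;
  hopf_onP : is_hopf eta mu eps delta lam
}.

Definition is_hopf_mor H epsH deltaH (SH : @hopf_on H epsH deltaH)
    B epsB deltaB (SB : @hopf_on B epsB deltaB) (f : hom H B) : Prop :=
  is_alg_mor (eta SH) (mu SH) (eta SB) (mu SB) f /\
  is_coalg_mor epsH deltaH epsB deltaB f.

Definition Gamma_of H eps delta (H1 H2 : @hopf_on H eps delta) :
    hom (H ⊗ H) H :=
  mu H1 ∘ (lam H1 ⊠ mu H2) ∘ asc H H H ∘ (delta ▷ H).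

Record hopf_brace := HopfBrace {
  hb_ob : C;
  hb_eps : hom hb_ob K;
  hb_delta : hom hb_ob (hb_ob ⊗ hb_ob);
  hb_1 : hopf_on hb_eps hb_delta;
  hb_2 : hopf_on hb_eps hb_delta;
  hb_compat :
    mu hb_2 ∘ (hb_ob ◁ mu hb_1) =
    mu hb_1 ∘ (mu hb_2 ⊠ Gamma_of hb_1 hb_2)
    ∘ mid_braid hb_ob hb_ob hb_ob hb_ob ∘ (hb_delta ▷ (hb_ob ⊗ hb_ob))
}.

Definition is_hopf_brace_mor (X Y : hopf_brace) (f : hom (hb_ob X) (hb_ob Y)) :=
  is_hopf_mor (hb_1 X) (hb_1 Y) f /\ is_hopf_mor (hb_2 X) (hb_2 Y) f.

(* (g ⊗ H) ∘ (H ⊗ c) ∘ (delta ⊗ H) is unchanged when delta is replaced by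
   c ∘ delta. *)
Definition cocomm_for H (delta : hom H (H ⊗ H)) (g : hom (H ⊗ H) H) : Prop :=
  (g ▷ H) ∘ asc' H H H ∘ (H ◁ braid H H) ∘ asc H H H ∘ (delta ▷ H) =
  (g ▷ H) ∘ asc' H H H ∘ (H ◁ braid H H) ∘ asc H H H
    ∘ ((braid H H ∘ delta) ▷ H).

Record is_s_hopf_brace (X : hopf_brace) : Prop := IsSHopfBrace {
  shb_cocomm : cocomm_for (hb_delta X) (Gamma_of (hb_1 X) (hb_2 X));
  shb_lam1_iso : is_iso (lam (hb_1 X));
  shb_lam2_iso : is_iso (lam (hb_2 X));
  shb_lam2_mul :
    let H := hb_ob X in
    let Gam := Gamma_of (hb_1 X) (hb_2 X) in
    let lam2 := lam (hb_2 X) in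
    mu (hb_1 X) ∘ (H ◁ Gam) ∘ asc H H H ∘ ((hb_delta X ∘ lam2) ▷ H) =
    mu (hb_1 X) ∘ (H ◁ Gam) ∘ asc H H H
      ∘ (((lam2 ⊠ lam2) ∘ hb_delta X) ▷ H);
  shb_lam2_inv :
    exists2 lam1V, is_inverse (lam (hb_1 X)) lam1V
    & Gamma_of (hb_1 X) (hb_2 X) ∘ (lam (hb_2 X) ▷ hb_ob X) ∘ hb_delta X =
      lam1V ∘ lam (hb_2 X)
}.

Record is_brace_triple H eps delta (S : @hopf_on H eps delta)
    (gam : hom (H ⊗ H) H) (T : hom H H) : Prop := IsBraceTriple {
  bt_lam_iso : is_iso (lam S);
  bt_cocomm : cocomm_for delta gam;
  bt_gam_coalg :
    is_coalg_mor (tens_eps eps eps) (tens_delta delta delta) eps delta gam;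
  bt_gam_mu :
    gam ∘ (H ◁ mu S) =
    mu S ∘ (gam ⊠ gam) ∘ mid_braid H H H H ∘ (delta ▷ (H ⊗ H));
  bt_gam_gam :
    gam ∘ (H ◁ gam) ∘ asc H H H =
    gam ∘ ((mu S ∘ (H ◁ gam) ∘ asc H H H ∘ (delta ▷ H)) ▷ H);
  bt_gam_eta : gam ∘ (eta S ▷ H) = lun H;
  bt_T_iso : is_iso T;
  bt_T_delta : delta ∘ T = braid H H ∘ (T ⊠ T) ∘ delta;
  bt_T_eps : eps ∘ T = eps;
  bt_T_mul :
    mu S ∘ (H ◁ gam) ∘ asc H H H ∘ ((delta ∘ T) ▷ H) =
    mu S ∘ (H ◁ gam) ∘ asc H H H ∘ (((T ⊠ T) ∘ delta) ▷ H);
  bt_gam_T : gam ∘ (H ◁ T) ∘ delta = lam S;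
  bt_gam_T_inv :
    exists2 lamV, is_inverse (lam S) lamV
    & gam ∘ (T ▷ H) ∘ delta = lamV ∘ T
}.

Record brace_triple := BraceTriple {
  bt_ob : C;
  bt_eps : hom bt_ob K;
  bt_delta : hom bt_ob (bt_ob ⊗ bt_ob);
  bt_hopf : hopf_on bt_eps bt_delta;
  bt_gam : hom (bt_ob ⊗ bt_ob) bt_ob;
  bt_T : hom bt_ob bt_ob;
  brace_tripleP : is_brace_triple bt_hopf bt_gam bt_T
}.

Definition is_brace_triple_mor (X Y : brace_triple)
    (f : hom (bt_ob X) (bt_ob Y)) : Prop :=
  is_hopf_mor (bt_hopf X) (bt_hopf Y) f /\
  f ∘ bt_gam X = bt_gam Y ∘ (f ⊠ f).

Lemma is_hopf_mor_id H eps delta (S : @hopf_on H eps delta) :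
  is_hopf_mor S S (idm H).
Proof. by do !split; rewrite ?tensm_id ?comp1m ?compm1. Qed.

Lemma is_hopf_mor_comp H epsH deltaH (SH : @hopf_on H epsH deltaH)
    A epsA deltaA (SA : @hopf_on A epsA deltaA)
    B epsB deltaB (SB : @hopf_on B epsB deltaB) (g : hom A B) (f : hom H A) :
  is_hopf_mor SA SB g -> is_hopf_mor SH SA f -> is_hopf_mor SH SB (g ∘ f).
Proof.
move=> [[g1 g2] [g3 g4]] [[f1 f2] [f3 f4]]; split; split.
- by rewrite -compA f1.
- by rewrite -compA f2 compA g2 -compA -tensm_comp.
- by rewrite compA g3.
- by rewrite compA g4 -compA f4 compA -tensm_comp.
Qed.

Lemma is_hopf_brace_mor_id X : is_hopf_brace_mor (X := X) (idm (hb_ob X)).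
Proof. by split; apply: is_hopf_mor_id. Qed.

Lemma is_hopf_brace_mor_comp X Y Z
    (g : hom (hb_ob Y) (hb_ob Z)) (f : hom (hb_ob X) (hb_ob Y)) :
  is_hopf_brace_mor g -> is_hopf_brace_mor f -> is_hopf_brace_mor (g ∘ f).
Proof. by move=> [g1 g2] [f1 f2]; split; apply: is_hopf_mor_comp; eauto. Qed.

Lemma is_brace_triple_mor_id X : is_brace_triple_mor (X := X) (idm (bt_ob X)).
Proof.
by split; [apply: is_hopf_mor_id | rewrite tensm_id comp1m compm1].
Qed.

Lemma is_brace_triple_mor_comp X Y Z
    (g : hom (bt_ob Y) (bt_ob Z)) (f : hom (bt_ob X) (bt_ob Y)) :
  is_brace_triple_mor g -> is_brace_triple_mor f ->
  is_brace_triple_mor (g ∘ f).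
Proof.
move=> [g1 g2] [f1 f2]; split; first by apply: is_hopf_mor_comp; eauto.
by rewrite -compA f2 compA g2 -compA -tensm_comp.
Qed.

Lemma sig_inj (T : Type) (P : T -> Prop) (u v : {x : T | P x}) :
  sval u = sval v -> u = v.
Proof.
by case: u v => [x px] [y py] /= e; case: _ / e py => py;
  rewrite (proof_irrelevance _ px py).
Qed.

Definition HBr : category.
Proof.
refine (@Category hopf_brace
  (fun X Y => {f : hom (hb_ob X) (hb_ob Y) | is_hopf_brace_mor f})
  (fun X => exist _ (idm (hb_ob X)) (is_hopf_brace_mor_id X))
  (fun X Y Z g f => exist _ (sval g ∘ sval f)
     (is_hopf_brace_mor_comp (svalP g) (svalP f))) _ _ _).
- by move=> X Y f; apply: sig_inj; apply: comp1m.
- by move=> X Y f; apply: sig_inj; apply: compm1.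
- by move=> X Y Z W h g f; apply: sig_inj; apply: compA.
Defined.

Definition sHBr : category :=
  full_subcategory (C := HBr) is_s_hopf_brace.

Definition BT : category.
Proof.
refine (@Category brace_triple
  (fun X Y => {f : hom (bt_ob X) (bt_ob Y) | is_brace_triple_mor f})
  (fun X => exist _ (idm (bt_ob X)) (is_brace_triple_mor_id X))
  (fun X Y Z g f => exist _ (sval g ∘ sval f)
     (is_brace_triple_mor_comp (svalP g) (svalP f))) _ _ _).
- by move=> X Y f; apply: sig_inj; apply: comp1m.
- by move=> X Y f; apply: sig_inj; apply: compm1.
- by move=> X Y Z W h g f; apply: sig_inj; apply: compA.
Defined.

End Hopf.

(* Main.v *)
(** Write x . y for the product of H_1, x o y for the product of H_2 and
    g(x, y) for the action Gamma_{H_1}.  The antipode of H_1 makes the map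
    f |-> x_1 . f(x_2) injective, so g is characterised by
    x o y = x_1 . g(x_2, y), and every axiom of a brace triple follows from an
    axiom of H_2 by convolving with x_1 (or with x_1 o y_1) and cancelling.
    Conversely, a brace triple (H, g, T) yields x o y = x_1 . g(x_2, y), whose
    antipode is T, and its Gamma is again g.

    The diagrammatic computations take place in the endofunctors of C: [A ⊗ -]
    replaces [A], so that the retyped identities of C disappear, and a morphism
    is then recorded by the number of strands to its left, [op n f s] being
    [f] applied after [s] on the strands n, n+1, ...  *)
From Stdlib Require Import ProofIrrelevance FunctionalExtensionality.
From mathcomp Require Import ssreflect ssrfun ssrbool eqtype ssrnat zify.
Require Import Defs.

Set Implicit Arguments.
Unset Strict Implicit.
Unset Printing Implicit Defensive.
Local Open Scope cat_scope.

(** * Strictification *)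

Section EqHom.
Variable C : category.

Lemma eq_hom_comp (a b c : C) (e : a = b) (e' : b = c) :
  eq_hom e' ∘ eq_hom e = eq_hom (etrans e e').
Proof. by case: _ / e'; rewrite comp1m. Qed.

(** Coherence in one stroke: parallel composites of associativity and unit constraints agree,
    because proofs of an equality between objects are irrelevant. *)
Lemma eq_hom_irr (a b : C) (e e' : a = b) : eq_hom e = eq_hom e'.
Proof. by rewrite (proof_irrelevance _ e e'). Qed.

Lemma eq_hom_idm (a : C) (e : a = a) : eq_hom e = idm a.
Proof. exact: (eq_hom_irr e erefl). Qed.

Lemma eq_homV (a b : C) (e : a = b) (e' : b = a) :
  eq_hom e' ∘ eq_hom e = idm a.
Proof. by rewrite eq_hom_comp eq_hom_idm. Qed.

End EqHom.

Lemma tens_eq_hom (C : strict_monoidal) (a b a' b' : C) (e : a = b)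
    (e' : a' = b') :
  eq_hom e ⊠ eq_hom e' = eq_hom (f_equal2 tens e e').
Proof.
destruct e, e'; rewrite [RHS]eq_hom_idm; exact: tensm_id.
Qed.

Lemma tens_eq_homr (C : strict_monoidal) (a a' b' : C) (e' : a' = b') :
  a ◁ eq_hom e' = eq_hom (f_equal2 tens erefl e').
Proof. exact: (tens_eq_hom erefl e'). Qed.

Lemma tens_eq_homl (C : strict_monoidal) (a a' b' : C) (e' : a' = b') :
  eq_hom e' ▷ a = eq_hom (f_equal2 tens e' erefl).
Proof. exact: (tens_eq_hom e' erefl). Qed.

(** * Flattening tensor products into endofunctors *)

Section Flat.
Variable C : strict_monoidal.
Implicit Types a b d Z : C.

Lemma tens_split a b a' b' (f : hom a b) (g : hom a' b') :
  f ⊠ g = (f ▷ b') ∘ (a ◁ g).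
Proof. by rewrite -tensm_comp compm1 comp1m. Qed.

Lemma tens_split' a b a' b' (f : hom a b) (g : hom a' b') :
  f ⊠ g = (b ◁ g) ∘ (f ▷ a').
Proof. by rewrite -tensm_comp compm1 comp1m. Qed.

Lemma tensr_comp a b c d (g : hom b c) (f : hom a b) :
  d ◁ (g ∘ f) = (d ◁ g) ∘ (d ◁ f).
Proof. by rewrite -tensm_comp compm1. Qed.

Lemma tensl_comp a b c d (g : hom b c) (f : hom a b) :
  (g ∘ f) ▷ d = (g ▷ d) ∘ (f ▷ d).
Proof. by rewrite -tensm_comp compm1. Qed.

Lemma asc_nat a b a' b' a'' b''
    (f : hom a b) (f' : hom a' b') (f'' : hom a'' b'') :
  asc b b' b'' ∘ (f ⊠ f' ⊠ f'') = (f ⊠ (f' ⊠ f'')) ∘ asc a a' a''.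
Proof. exact: tensmA. Qed.

Lemma ascK a b d : asc' a b d ∘ asc a b d = idm _.
Proof. exact: eq_homV. Qed.

Lemma asc'K a b d : asc a b d ∘ asc' a b d = idm _.
Proof. exact: eq_homV. Qed.

(* [fl] turns [- ⊗ Z] into an endofunctor of Z that is built from
   [H ⊗ -] alone, so that reassociation of flattened objects is conversion. *)
Structure flat := Flat {
  fl_ob :> C;
  fl : C -> C;
  flm : forall Z Z', hom Z Z' -> hom (fl Z) (fl Z');
  flat_in : forall Z, hom (fl_ob ⊗ Z) (fl Z);
  flat_out : forall Z, hom (fl Z) (fl_ob ⊗ Z);
  flat_outK : forall Z, flat_in Z ∘ flat_out Z = idm (fl Z);
  flat_inK : forall Z, flat_out Z ∘ flat_in Z = idm (fl_ob ⊗ Z);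
  flat_nat : forall Z Z' (h : hom Z Z'),
    flat_in Z' ∘ (fl_ob ◁ h) = flm h ∘ flat_in Z
}.
Arguments flm s {Z Z'} h : rename.

Lemma flat_nat' (s : flat) Z Z' (h : hom Z Z') :
  (s ◁ h) ∘ flat_out s Z = flat_out s Z' ∘ flm s h.
Proof.
rewrite -[LHS]comp1m -(flat_inK s) -compA; congr (_ ∘ _).
by rewrite compA flat_nat -compA flat_outK compm1.
Qed.

Definition flat_letter (H : C) : flat.
Proof.
refine (@Flat H (fun Z => H ⊗ Z) (fun _ _ h => H ◁ h)
  (fun Z => idm _) (fun Z => idm _) _ _ _).
- by move=> Z; rewrite comp1m.
- by move=> Z; rewrite comp1m.
- by move=> Z Z' h; rewrite comp1m compm1.
Defined.

Definition flat_unit : flat.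
Proof.
refine (@Flat tunit (fun Z => Z) (fun _ _ h => h)
  (fun Z => lun Z) (fun Z => lun' Z) _ _ _).
- by move=> Z; apply: eq_homV.
- by move=> Z; apply: eq_homV.
- by move=> Z Z' h; apply: tens1m.
Defined.

Definition flat_tens (s t : flat) : flat.
Proof.
refine (@Flat (s ⊗ t) (fun Z => fl s (fl t Z)) (fun _ _ h => flm s (flm t h))
  (fun Z => flat_in s (fl t Z) ∘ (s ◁ flat_in t Z) ∘ asc s t Z)
  (fun Z => asc' s t Z ∘ (s ◁ flat_out t Z) ∘ flat_out s (fl t Z)) _ _ _).
- move=> Z; rewrite -!compA [asc _ _ _ ∘ _]compA asc'K comp1m.
  by rewrite [(s ◁ _) ∘ _]compA -tensr_comp flat_outK tensm_id comp1m
    flat_outK.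
- move=> Z; rewrite -!compA [flat_out _ _ ∘ _]compA flat_inK comp1m.
  by rewrite [(s ◁ _) ∘ _]compA -tensr_comp flat_inK tensm_id comp1m ascK.
- move=> Z Z' h; rewrite -compA -tensm_id asc_nat -compA.
  rewrite [(s ◁ _) ∘ _]compA -tensr_comp flat_nat tensr_comp.
  by rewrite !compA flat_nat.
Defined.

(* Locked so that rewriting with [compA] does not see through it. *)
Definition cay (s t : flat) (f : hom s t) Z : hom (fl s Z) (fl t Z) :=
  locked (flat_in t Z ∘ (f ▷ Z) ∘ flat_out s Z).

Lemma cay_nat (s t : flat) (f : hom s t) Z Z' (h : hom Z Z') :
  cay f Z' ∘ flm s h = flm t h ∘ cay f Z.
Proof.
rewrite /cay -!lock -!compA -flat_nat' [(f ▷ _) ∘ _]compA -tens_split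
  tens_split'.
by rewrite !compA flat_nat.
Qed.

Lemma cay_comp (r s t : flat) (g : hom s t) (f : hom r s) Z :
  @cay r t (g ∘ f) Z = cay g Z ∘ cay f Z.
Proof.
rewrite /cay -!lock tensl_comp -!compA [flat_out _ _ ∘ _]compA flat_inK.
by rewrite comp1m.
Qed.

(** Tensoring becomes horizontal composition of natural transformations; in this form the right
    factor acts first. *)
Lemma cay_tens (s t s' t' : flat) (f : hom s t) (f' : hom s' t') Z :
  @cay (flat_tens s s') (flat_tens t t') (f ⊠ f') Z =
  cay f (fl t' Z) ∘ flm s (cay f' Z).
Proof.
rewrite /cay -!lock /= -!compA; congr (_ ∘ _).
rewrite -flat_nat' [asc _ _ _ ∘ _]compA asc_nat -compA.
rewrite [asc _ _ _ ∘ _]compA asc'K comp1m !compA -!tensm_comp.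
by rewrite !comp1m !compm1.
Qed.

Lemma cay_id (s : flat) Z : cay (idm s) Z = idm (fl s Z).
Proof. by rewrite /cay -!lock tensm_id compm1 flat_outK. Qed.

Lemma flm_id (s : flat) Z : flm s (idm Z) = idm (fl s Z).
Proof.
by rewrite -[LHS]compm1 -(flat_outK s) compA -flat_nat tensm_id compm1.
Qed.

(** Faithfulness of flattening: the component at the unit object determines [f ▷ tunit], and the
    unit constraint recovers [f] from it. *)
Lemma cay_inj (s t : flat) (f g : hom s t) :
  cay f tunit = cay g tunit -> f = g.
Proof.
move=> e; have {}e : f ▷ tunit = g ▷ tunit.
  have c (h : hom s t) :
      h ▷ tunit = flat_out t tunit ∘ cay h tunit ∘ flat_in s tunit.
    by rewrite /cay -!lock !compA flat_inK comp1m -compA flat_inK compm1.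
  by rewrite c e -c.
have run_nat (h : hom s t) : h ∘ eq_hom (tenso1 s) = run t ∘ (h ▷ tunit).
  by rewrite tensm1.
have eK := @eq_homV C _ _ (esym (tenso1 s)) (tenso1 s).
rewrite -[f]compm1 -[g]compm1 -eK !compA !run_nat.
by rewrite e.
Qed.

(** Both bracketings flatten to the same composite functor by conversion, so the identity has the
    right type; what remains is an equality of constraints, closed by [eq_hom_irr]. *)
Lemma cay_asc (r s t : flat) Z :
  @cay (flat_tens (flat_tens r s) t) (flat_tens r (flat_tens s t))
    (asc r s t) Z = idm _.
Proof.
rewrite -[RHS](flat_outK (flat_tens (flat_tens r s) t)) /cay -lock.
congr (_ ∘ _) => /=; rewrite !tensr_comp -!compA; congr (_ ∘ _).
rewrite [asc r s _ ∘ _]compA.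
have -> : (r ⊗ s) ◁ flat_in t Z = idm r ⊠ idm s ⊠ flat_in t Z.
  by rewrite tensm_id.
rewrite asc_nat -!compA; do 2!congr (_ ∘ _).
rewrite /asc tens_eq_homl tens_eq_homr !eq_hom_comp; exact: eq_hom_irr.
Qed.

Lemma cay_asc' (r s t : flat) Z :
  @cay (flat_tens r (flat_tens s t)) (flat_tens (flat_tens r s) t)
    (asc' r s t) Z = idm _.
Proof.
rewrite -[LHS]comp1m -[X in X ∘ _](cay_asc r s t) /=.
rewrite -(@cay_comp (flat_tens r (flat_tens s t))
  (flat_tens (flat_tens r s) t) (flat_tens r (flat_tens s t))) asc'K.
exact: (cay_id (flat_tens r (flat_tens s t))).
Qed.

Lemma cay_lun (s : flat) Z :
  @cay (flat_tens flat_unit s) s (lun s) Z = idm _.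
Proof.
rewrite -[RHS](flat_outK (flat_tens flat_unit s)) /cay -lock.
congr (_ ∘ _) => /=; rewrite /lun tens1m -compA; congr (_ ∘ _).
rewrite tens_eq_homl /asc eq_hom_comp; exact: eq_hom_irr.
Qed.

Lemma cay_lun' (s : flat) Z :
  @cay s (flat_tens flat_unit s) (lun' s) Z = idm _.
Proof.
rewrite -[LHS]comp1m -[X in X ∘ _](cay_lun s Z).
rewrite -(@cay_comp s (flat_tens flat_unit s) s) eq_homV.
exact: cay_id.
Qed.

Lemma cay_run (s : flat) Z :
  @cay (flat_tens s flat_unit) s (run s) Z = idm _.
Proof.
rewrite -[RHS](flat_outK (flat_tens s flat_unit)) /cay -lock.
congr (_ ∘ _) => /=; rewrite -compA; congr (_ ∘ _).
rewrite /run /lun tens_eq_homl tens_eq_homr /asc eq_hom_comp; exact: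
  eq_hom_irr.
Qed.

End Flat.

(** * Diagrams as words in a monoid with a shift *)

(* [sh x] is [x] with one more strand on the left. *)
Record shift_monoid := ShiftMonoid {
  car :> Type;
  one : car;
  mulm : car -> car -> car;
  sh : car -> car;
  mulmA : forall x y z, mulm x (mulm y z) = mulm (mulm x y) z;
  mul1m : forall x, mulm one x = x;
  mulm1 : forall x, mulm x one = x;
  shM : forall x y, sh (mulm x y) = mulm (sh x) (sh y)
}.
Arguments one {s}.
Arguments mulm {s} x y : rename.
Arguments sh {s} x : rename.

Notation "x * y" := (mulm x y) : cat_scope.

(** A generator with [a] inputs and [b] outputs. [gel_nat] is the interchange law with anything on
    its right. In [gel_out], the shifted [one] is only a partial identity, defined from [b] strands
    on. *)
Record gen (M : shift_monoid) (a b : nat) := Gen {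
  gel :> M;
  gel_nat : forall x : M, gel * iter a sh x = iter b sh x * gel;
  gel_out : iter b sh one * gel = gel
}.

Section Op.
Variable M : shift_monoid.
Implicit Types (x y s : M) (n k : nat).

Definition op n x s : M := iter n sh x * s.

(* [wide k s]: wherever [s] is defined, its target has at least [k] strands. *)
Definition wide k s : Prop := op k one s = s.

Lemma iter_shM n x y : iter n sh (x * y) = iter n sh x * iter n sh y.
Proof. by elim: n => //= n ->; rewrite shM. Qed.

Lemma opM n x y s : op n (x * y) s = op n x (op n y s).
Proof. by rewrite /op iter_shM mulmA. Qed.

Lemma opS n x s : op n (sh x) s = op n.+1 x s.
Proof. by rewrite /op -iterSr. Qed.

Lemma op_iter n k x s : op n (iter k sh x) s = op (k + n) x s.
Proof. by rewrite /op -iterD addnC. Qed.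

(** Interchange law, with [k] strands between [f] and [x]; sliding [x] past [f] changes its position
    by [b - a]. *)
Lemma xch a b (f : gen M a b) n k x s :
  op n f (op (a + k + n) x s) = op (b + k + n) x (op n f s).
Proof.
rewrite -![in RHS]op_iter -![in LHS]op_iter -!opM; congr op.
by rewrite !iterD gel_nat.
Qed.

Lemma op_one s : op 0 one s = s.
Proof. exact: mul1m. Qed.

Lemma wide_le k j s : wide k s -> j <= k -> wide j s.
Proof.
rewrite /wide => <- /subnK <-; rewrite -op_iter -opM.
by rewrite mul1m.
Qed.

Lemma wide_op a b (f : gen M a b) n j s :
  wide (a + (j - b)) s -> wide j (op n f s).
Proof.
move=> ws; have [le_j|lt_j] := leqP j (b + n).
  by apply: (@wide_le (b + n)) => //; rewrite /wide -op_iter -opM gel_out.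
(* Beyond the outputs of [f], interchange moves the partial identity before [f], where [ws] absorbs
   it. *)
have -> : j = b + (j - b - n) + n by lia.
rewrite /wide -xch; congr op; rewrite -[RHS]ws; congr op; lia.
Qed.

Lemma wide_out a b (f : gen M a b) n j s : j <= b + n -> wide j (op n f s).
Proof.
by apply: wide_le; rewrite /wide -op_iter -opM gel_out.
Qed.

Lemma wide_op_wide n k j x s : wide k x -> j <= k + n -> wide j (op n x s).
Proof.
by move=> wx; apply: wide_le; rewrite /wide -op_iter -opM [iter _ _ _ * _]wx.
Qed.

Lemma op_op n k x y s : op n (op k x y) s = op (k + n) x (op n y s).
Proof. by rewrite opM op_iter. Qed.

Lemma op_one_wide n s : wide n s -> op n one s = s.
Proof. by []. Qed.

End Op.
Arguments xch {M a b} f n k x s.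
Arguments op : simpl never.

Ltac wide_tac :=
  repeat first
    [ match goal with ws : wide _ ?s |- wide _ ?s =>
        apply: (wide_le ws); lia end
    | match goal with wx : wide _ ?x |- wide _ (op _ ?x _) =>
        apply: (wide_op_wide _ wx); lia end
    | solve [apply: wide_out; lia]
    | apply: wide_op ].

(* With this hint, [//] discharges the width conditions in the rewriting chains. *)
#[export] Hint Extern 0 (wide _ _) => solve [wide_tac] : core.

(** * Hopf algebras in a shift monoid *)

Record coalg (M : shift_monoid) := Coalg {
  cdl : gen M 1 2;
  cep : gen M 1 0;
  cbr : gen M 2 2;
  dlA0 : cdl * cdl = sh cdl * cdl;
  epl0 : cep * cdl = sh one;
  epr0 : sh cep * cdl = sh one;
  br_dll0 : sh cdl * cbr = cbr * sh cbr * cdl;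
  br_dlr0 : cdl * cbr = sh cbr * cbr * sh cdl;
  br_epl0 : cep * cbr = sh cep
}.

(** Naturality of the braiding at [g], in either argument. An abstract shift monoid has no such law,
    so each instance is recorded as data. *)
Definition nat21 M (K : coalg M) (g : gen M 2 1) : Prop :=
  cbr K * g = sh g * cbr K * sh (cbr K) /\
  cbr K * sh g = g * sh (cbr K) * cbr K.

Definition nat11 M (K : coalg M) (g : gen M 1 1) : Prop :=
  cbr K * g = sh g * cbr K /\ cbr K * sh g = g * cbr K.

Record hopf M (K : coalg M) := Hopf {
  hmu : gen M 2 1;
  het : gen M 0 1;
  han : gen M 1 1;
  muA0 : hmu * hmu = hmu * sh hmu;
  mul10 : hmu * het = sh one;
  mur10 : hmu * sh het = sh one;
  dl_mu0 : cdl K * hmu =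
    hmu * sh (sh hmu) * sh (cbr K) * cdl K * sh (cdl K);
  dl_et0 : cdl K * het = het * het;
  ep_mu0 : cep K * hmu = cep K * cep K;
  ep_et0 : cep K * het = one;
  anl0 : hmu * han * cdl K = het * cep K;
  anr0 : hmu * sh han * cdl K = het * cep K;
  br_mu0 : nat21 K hmu;
  br_etl0 : cbr K * het = sh het;
  br_etr0 : cbr K * sh het = het * sh one;
  br_an0 : nat11 K han
}.

Unset Implicit Arguments.

(** Turns an equation of words into one with [n] strands on the left and an arbitrary earlier word
    [s], the form in which it can rewrite. *)
Ltac lift E n s :=
  have := congr1 (fun x => op n x s) E; rewrite !(opM, opS) ?op_one.

Section CoalgRules.
Context {M : shift_monoid} (K : coalg M).
Implicit Types (n : nat) (s : M).
Notation δ := (cdl K).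
Notation ε := (cep K).
Notation c := (cbr K).

Lemma dlA n s : op n δ (op n δ s) = op n.+1 δ (op n δ s).
Proof. by lift (dlA0 K) n s. Qed.

Lemma epl n s : wide n.+1 s -> op n ε (op n δ s) = s.
Proof. by lift (epl0 K) n s => ->. Qed.

Lemma epr n s : wide n.+1 s -> op n.+1 ε (op n δ s) = s.
Proof. by lift (epr0 K) n s => ->. Qed.

Lemma br_dll n s : op n.+1 δ (op n c s) = op n c (op n.+1 c (op n δ s)).
Proof. by lift (br_dll0 K) n s. Qed.

Lemma br_dlr n s : op n δ (op n c s) = op n.+1 c (op n c (op n.+1 δ s)).
Proof. by lift (br_dlr0 K) n s. Qed.

Lemma br_epl n s : op n ε (op n c s) = op n.+1 ε s.
Proof. by lift (br_epl0 K) n s. Qed.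

Lemma br_l2 {g : gen M 2 1} (gP : nat21 K g) n s :
  op n c (op n g s) = op n.+1 g (op n c (op n.+1 c s)).
Proof. by case: gP => E _; lift E n s. Qed.

Lemma br_r2 {g : gen M 2 1} (gP : nat21 K g) n s :
  op n c (op n.+1 g s) = op n g (op n.+1 c (op n c s)).
Proof. by case: gP => _ E; lift E n s. Qed.

Lemma br_l1 {g : gen M 1 1} (gP : nat11 K g) n s : op n c
  (op n g s) = op n.+1 g (op n c s).
Proof. by case: gP => E _; lift E n s. Qed.

Lemma br_r1 {g : gen M 1 1} (gP : nat11 K g) n s : op n c
  (op n.+1 g s) = op n g (op n c s).
Proof. by case: gP => _ E; lift E n s. Qed.

End CoalgRules.
Arguments br_l2 {M K g} gP n s.
Arguments br_r2 {M K g} gP n s.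
Arguments br_l1 {M K g} gP n s.
Arguments br_r1 {M K g} gP n s.

Section HopfRules.
Context {M : shift_monoid} {K : coalg M} (S : hopf K).
Implicit Types (n : nat) (s x y : M).
Notation δ := (cdl K).
Notation ε := (cep K).
Notation c := (cbr K).
Notation μ := (hmu S).
Notation η := (het S).
Notation λ := (han S).

Lemma muA n s : op n μ (op n μ s) = op n μ (op n.+1 μ s).
Proof. by lift (muA0 S) n s. Qed.

Lemma mul1 n s : wide n.+1 s -> op n μ (op n η s) = s.
Proof. by lift (mul10 S) n s => ->. Qed.

Lemma mur1 n s : wide n.+1 s -> op n μ (op n.+1 η s) = s.
Proof. by lift (mur10 S) n s => ->. Qed.

Lemma dl_mu n s :
  op n δ (op n μ s) = op n μ (op n.+2 μ (op n.+1 c (op n δ (op n.+1 δ s)))).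
Proof. by lift (dl_mu0 S) n s. Qed.

Lemma dl_et n s : op n δ (op n η s) = op n η (op n η s).
Proof. by lift (dl_et0 S) n s. Qed.

Lemma ep_mu n s : op n ε (op n μ s) = op n ε (op n ε s).
Proof. by lift (ep_mu0 S) n s. Qed.

Lemma ep_et n s : wide n s -> op n ε (op n η s) = s.
Proof. by lift (ep_et0 S) n s => ->. Qed.

Lemma anl n s : op n μ (op n λ (op n δ s)) = op n η (op n ε s).
Proof. by lift (anl0 S) n s. Qed.

Lemma anr n s : op n μ (op n.+1 λ (op n δ s)) = op n η (op n ε s).
Proof. by lift (anr0 S) n s. Qed.

Lemma br_etl n s : op n c (op n η s) = op n.+1 η s.
Proof. by lift (br_etl0 S) n s. Qed.

Lemma br_etr n s : wide n.+1 s -> op n c (op n.+1 η s) = op n η s.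
Proof. by lift (br_etr0 S) n s => -> ->. Qed.

End HopfRules.

(** * Properties of the antipode, and cancellation for convolution *)

Section HopfTheory.
Context {M : shift_monoid} {K : coalg M} (S : hopf K).
Implicit Types (n : nat) (s x y : M).
Notation δ := (cdl K).
Notation ε := (cep K).
Notation c := (cbr K).
Notation μ := (hmu S).
Notation η := (het S).
Notation λ := (han S).

(** The unit is grouplike: lam(1) = lam(1) . 1 is the antipode identity at 1. *)
Lemma an_et n s :
  wide n s ->
  op n λ (op n η s) =
  op n η s.
Proof.
move=> ws; set r := RHS.
by rewrite -(mur1 S n (op n λ (op n η s))) // -(xch λ n 0 η) -(xch η n 0 η)
  -(dl_et S n) (anl S n) (ep_et S n) //.
Qed.

Lemma ep_an n s :
  wide n.+1 s ->
  op n ε (op n λ s) =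
  op n ε s.
Proof.
move=> ws; set r := RHS.
by rewrite -(epl K n s) // -(xch ε n 0 λ) -(ep_mu S n) (anr S n)
  (ep_et S n) //.
Qed.

(* Associativity (p q) r = p (q r) in H ⊗ H when p and q are coproducts. *)
Lemma tens_mu_dlA n s :
  op n μ (op n.+2 μ (op n.+1 c (op n δ (op n.+1 μ (op n.+3 μ (op n.+2 c
    (op n.+1 δ s))))))) =
  op n μ (op n.+2 μ (op n.+1 c (op n δ (op n μ s)))).
Proof.
set r := RHS.
by rewrite (xch δ n 0 μ) (xch δ n 2 μ) (xch δ n 1 c) (br_r2 (br_mu0 S) n.+1)
  (xch c n.+1 1 μ) (xch c n.+1 0 c) (xch c n.+2 0 μ) -(xch μ n.+1 0 μ)
  -(muA S n) -(muA S n.+3) (xch μ n 1 μ) -(br_l2 (br_mu0 S) n.+2) (xch μ n 0 c)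
  -(dl_mu S n).
Qed.

(** lam(h_1) . (h_2 . x(h_3)) = x(h). In the names of the cancellation lemmas, the first digit
    counts the strands that are comultiplied, the second the tensor factors of the target that are
    multiplied. *)
Lemma cancel11_inv x n s :
  wide 1 x -> wide n.+1 s ->
  op n μ (op n λ (op n.+1 μ (op n.+2 x (op n.+1 δ (op n δ s))))) =
  op n x s.
Proof.
move=> wx ws; set r := RHS.
by rewrite (xch λ n 0 μ) -(dlA K n) -(xch δ n 0 x) -(muA S n) (anl S n)
  (xch ε n 0 x) (mul1 S n) // (epl K n) //.
Qed.

(** In the algebra H ⊗ H, the convolution inverse of [δ] is [δ] after [λ], since [δ] is
    multiplicative. *)
Lemma cancel12_inv x n s :
  wide 2 x -> wide n.+1 s ->
  op n μ (op n.+2 μ (op n.+1 c (op n δ (op n λ (op n.+1 μ (op n.+3 μ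
    (op n.+2 c (op n.+1 δ (op n.+2 x (op n.+1 δ (op n δ s))))))))))) =
  op n x s.
Proof.
move=> wx ws; set r := RHS.
by rewrite (xch λ n 0 μ) (xch λ n 2 μ) (xch λ n 1 c) (xch λ n 0 δ) -(dlA K n)
  -(xch δ n 0 x) (tens_mu_dlA n) (xch μ n 0 μ) (anl S n) (xch ε n 0 x)
    (dl_et S n)
  -(xch η n 0 c) (br_etl S n) (epl K n) // (mul1 S n) // (mul1 S n.+1) //.
Qed.

(* Coassociativity of H ⊗ H. *)
Lemma tens_dlA n s :
  op n.+3 c (op n.+2 δ (op n.+3 δ (op n.+1 c (op n δ (op n.+1 δ s))))) =
  op n.+1 c (op n δ (op n.+1 δ (op n.+1 c (op n δ (op n.+1 δ s))))).
Proof.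
set r := RHS.
by rewrite -(xch c n.+1 0 δ) -(xch δ n 1 δ) (br_dll K n.+1) -(xch c n.+1 0 c)
  -(dlA K n) -(xch δ n 0 c) -(xch δ n 1 c) -(dlA K n.+1) (xch δ n 0 δ)
  -(br_dlr K n.+1).
Qed.

Section Cancel.
Variable f : gen M 2 1.
Hypothesis dl_f : forall n s, op n δ (op n f s) =
  op n f (op n.+2 f (op n.+1 c (op n δ (op n.+1 δ s)))).
Hypothesis ep_f : forall n s, op n ε (op n f s) = op n ε (op n ε s).

(** As [f] is a coalgebra morphism from H ⊗ H, [λ] after [f] is its convolution inverse. The uses
    are [f = μ] and the second product of a brace. *)
Lemma cancel21_inv x n s :
  wide 1 x -> wide n.+2 s ->
  op n μ (op n λ (op n f (op n.+2 μ (op n.+2 f (op n.+4 x (op n.+3 c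
    (op n.+2 δ (op n.+3 δ (op n.+1 c (op n δ (op n.+1 δ s))))))))))) =
  op n x s.
Proof.
move=> wx ws; set r := RHS.
by rewrite (xch f n.+2 0 x) (xch f n 0 μ) (xch f n 1 x) (xch λ n 0 μ)
  -(muA S n) (tens_dlA n) -(dl_f n) -(xch δ n 0 x) (anl S n) (xch ε n 0 x)
    (ep_f n)
  (xch ε n 0 c) (epl K n) // (br_epl K n) (epl K n.+1) // (mul1 S n) //.
Qed.

Lemma cancel21 p x y : wide 1 x -> wide 1 y ->
  (forall n s, wide (p + n.+2) s ->
    op n μ (op n f (op n.+2 x (op n.+1 c (op n δ (op n.+1 δ s))))) =
    op n μ (op n f (op n.+2 y (op n.+1 c (op n δ (op n.+1 δ s)))))) ->
  forall n s, wide (p + n.+2) s -> op n x s = op n y s.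
Proof.
move=> wx wy E n s ws.
by rewrite -(cancel21_inv x n s) // -(cancel21_inv y n s) // E.
Qed.

End Cancel.

Lemma mu_an_mu n s :
  op n μ (op n μ (op n.+2 λ (op n.+2 μ (op n.+1 c (op n δ (op n.+1 δ s)))))) =
  op n η (op n ε (op n ε s)).
Proof.
set r := RHS.
by rewrite (xch μ n 0 λ) -(dl_mu S n) (anr S n) (ep_mu S n).
Qed.

Lemma mu_br_an n s :
  wide n.+2 s ->
  op n μ (op n μ (op n.+2 μ (op n.+3 λ (op n.+2 λ (op n.+2 c (op n.+1 c
    (op n δ (op n.+1 δ s)))))))) =
  op n η (op n ε (op n ε s)).
Proof.
move=> ws; set r := RHS.
by rewrite (xch δ n 0 δ) (xch μ n 0 μ) (xch μ n 1 λ) -(br_dlr K n.+1)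
  -(muA S n)
  (xch μ n 0 λ (op n μ (op n.+2 λ (op n.+1 δ (op n.+1 c (op n δ s))))))
  (muA S n) (anr S n.+1) (mur1 S n) // (br_epl K n.+1) -(xch δ n 0 ε) (anr S n)
  (xch ε n 0 ε).
Qed.

Lemma tens_mu_dl_an n s :
  op n μ (op n.+2 μ (op n.+1 c (op n δ (op n.+1 δ (op n.+1 λ (op n δ s)))))) =
  op n η (op n η (op n ε s)).
Proof.
set r := RHS.
by rewrite -(dl_mu S n) (anr S n) (dl_et S n).
Qed.

Lemma tens_mu_an_dl n s :
  wide n.+1 s ->
  op n μ (op n.+2 μ (op n.+1 c (op n δ (op n.+1 c (op n.+2 λ (op n.+1 λ
    (op n.+1 δ (op n δ s)))))))) =
  op n η (op n η (op n ε s)).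
Proof.
move=> ws; set r := RHS.
by rewrite -(xch λ n.+1 0 λ) (xch δ n 0 c) (xch δ n 0 λ) -(dlA K n)
  -(xch δ n 0 λ (op n δ s)) (dlA K n) -(br_l2 (br_mu0 S) n.+1) (anr S n.+1)
  (epr K n) // (br_etl S n.+1) (xch μ n 0 η) (anr S n) -(xch η n 0 η).
Qed.

Lemma cancel11 p x y : wide 1 x -> wide 1 y ->
  (forall n s, wide (p + n.+1) s ->
    op n μ (op n.+1 x (op n δ s)) = op n μ (op n.+1 y (op n δ s))) ->
  forall n s, wide (p + n.+1) s -> op n x s = op n y s.
Proof.
move=> wx wy E n s ws.
by rewrite -(cancel11_inv x n s) // -(cancel11_inv y n s) // E.
Qed.

Lemma cancel12 p x y : wide 2 x -> wide 2 y ->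
  (forall n s, wide (p + n.+1) s ->
    op n μ (op n.+2 μ (op n.+1 c (op n δ (op n.+1 x (op n δ s))))) =
    op n μ (op n.+2 μ (op n.+1 c (op n δ (op n.+1 y (op n δ s)))))) ->
  forall n s, wide (p + n.+1) s -> op n x s = op n y s.
Proof.
move=> wx wy E n s ws.
by rewrite -(cancel12_inv x n s) // -(cancel12_inv y n s) // E.
Qed.

(** Both sides are right convolution inverses of [μ], by [mu_an_mu] and [mu_br_an], and [cancel21]
    identifies them. *)
Lemma an_mu n s : wide n.+2 s ->
  op n λ (op n μ s) = op n μ (op n.+1 λ (op n λ (op n c s))).
Proof.
move=> ws; have := cancel21 μ (dl_mu S) (ep_mu S) 0 (op 0 λ μ)
  (op 0 μ (op 1 λ (op 0 λ c))) _ _ _ n s ws.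
rewrite !op_op; apply => // {ws} {}n {}s ws.
by rewrite !op_op mu_an_mu mu_br_an.
Qed.

(** Dual argument: both sides are right convolution inverses of [δ] with values in the algebra H ⊗
    H. *)
Lemma dl_an n s : wide n.+1 s ->
  op n δ (op n λ s) = op n c (op n.+1 λ (op n λ (op n δ s))).
Proof.
move=> ws; have := cancel12 0 (op 0 δ λ) (op 0 c (op 1 λ
  (op 0 λ δ))) _ _ _ n s ws.
rewrite !op_op; apply => // {ws} {}n {}s ws.
by rewrite !op_op tens_mu_dl_an tens_mu_an_dl.
Qed.

End HopfTheory.
(** * From the brace identities to the triple identities *)

Section BraceToTriple.
Context {M : shift_monoid} {K : coalg M} (S S2 : hopf K).
Implicit Types (n : nat) (s x y : M).
Notation δ := (cdl K).
Notation ε := (cep K).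
Notation c := (cbr K).
Notation μ := (hmu S).
Notation η := (het S).
Notation λ := (han S).
Notation μ2 := (hmu S2).
Notation η2 := (het S2).
Notation λ2 := (han S2).

Variable γ : gen M 2 1.
Hypothesis br_gam : nat21 K γ.

Hypothesis gamE : forall n s, op n γ s =
  op n μ (op n λ (op n.+1 μ2 (op n δ s))).

Hypothesis compat : forall n s, op n μ2 (op n.+1 μ s) =
  op n μ (op n μ2 (op n.+2 γ (op n.+1 c (op n δ s)))).

Hypothesis cocom : forall n s, op n γ (op n.+1 c (op n δ s)) =
  op n γ (op n.+1 c (op n c (op n δ s))).

(** x_1 . g(x_2, y) = x_1 . lam(x_2) . (x_3 o y) = x o y. *)
Lemma mu2E n s :
  wide n.+2 s ->
  op n μ2 s =
  op n μ (op n.+1 γ (op n δ s)).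
Proof.
move=> ws; symmetry; set r := RHS.
by rewrite (gamE n.+1) -(muA S n) -(dlA K n) -(xch δ n 0 μ2) (anr S n)
  (xch ε n 0 μ2) (epl K n) // (mul1 S n) //.
Qed.

(** Both sides are x o (y . z): the left one by [mu2E], the right one by [compat] followed by
    [mu2E]. *)
Lemma gam_mu_conv n s :
  wide n.+3 s ->
  op n μ (op n.+1 γ (op n.+2 μ (op n δ s))) =
  op n μ (op n.+1 μ (op n.+1 γ (op n.+3 γ (op n.+2 c (op n.+1 δ
    (op n δ s)))))).
Proof.
move=> ws; set r := RHS.
by rewrite -(xch δ n 0 μ) -(mu2E n) // (compat n) (mu2E n) // (xch δ n 1 γ)
  (xch δ n 0 c) (dlA K n) (muA S n).
Qed.

Lemma gam_mu n s : wide n.+3 s ->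
  op n γ (op n.+1 μ s) =
  op n μ (op n γ (op n.+2 γ (op n.+1 c (op n δ s)))).
Proof.
(* The constant 2 stands for y and z, which are carried along while only x is convolved. *)
move=> ws; have := cancel11 S 2 (op 0 γ (op 1 μ one))
  (op 0 μ (op 0 γ (op 2 γ (op 1 c δ)))) _ _ _ n s ws.
rewrite !op_op ?op_one_wide //; apply => // {ws} {}n {}s ws.
by rewrite !op_op ?op_one_wide // gam_mu_conv.
Qed.

(* The compatibility condition with the unit of H_2 as its first argument. *)
Lemma mu_gam_et2 n s :
  wide n.+2 s ->
  op n μ (op n.+1 γ (op n.+1 η2 s)) =
  op n μ s.
Proof.
move=> ws; symmetry; set r := RHS.
by rewrite -(mul1 S2 n (op n μ s)) // (xch η2 n 0 μ) (compat n) (xch μ2 n 0 γ)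
  (dl_et S2 n) -(xch η2 n 0 c) (br_etl S2 n) (mul1 S2 n) //.
Qed.

Lemma gam_et2 n s :
  wide n.+1 s ->
  op n γ (op n η2 s) =
  s.
Proof.
move=> ws; set r := RHS.
by rewrite -(mul1 S n (op n γ (op n η2 s))) // (xch η n 0 γ) (xch η n 0 η2)
  (mu_gam_et2 n) // (mul1 S n) //.
Qed.

(** Write 1_2 for the unit of H_2, which is grouplike: lam(1_2) . y = lam(1_2) . (1_2 o y) = g(1_2,
    y) = y. *)
Lemma an_mu_et2 n s :
  wide n.+1 s ->
  op n μ (op n λ (op n η2 s)) =
  s.
Proof.
move=> ws; set r := RHS.
by rewrite -(mul1 S2 n.+1 (op n η2 s)) // -(xch η2 n 0 η2) -(dl_et S2 n)
  -(gamE n) (gam_et2 n) //.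
Qed.

Lemma an_et2 n s :
  wide n s ->
  op n λ (op n η2 s) =
  op n η s.
Proof.
move=> ws; set r := RHS.
by rewrite -(mur1 S n (op n λ (op n η2 s))) // -(xch λ n 0 η) -(xch η2 n 0 η)
  (an_mu_et2 n) //.
Qed.

(** By [an_et2], 1_2 = 1_2 . 1 = 1_2 . lam(1_2), which is 1 because 1_2 is grouplike. *)
Lemma et2E n s :
  wide n s ->
  op n η2 s =
  op n η s.
Proof.
move=> ws; set r := RHS.
by rewrite -(mur1 S n (op n η2 s)) // -(an_et2 n.+1) // -(xch η2 n 0 η2)
  -(dl_et S2 n) (anr S n) (ep_et S2 n).
Qed.

Lemma gam_et n s :
  wide n.+1 s ->
  op n γ (op n η s) =
  s.
Proof.
move=> ws; set r := RHS.
by rewrite -(et2E n) // (gam_et2 n) //.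
Qed.

(* Both sides are (x o y) o z, the left one through x o (y o z). *)
Lemma gam_gam_conv n s :
  wide n.+3 s ->
  op n μ (op n μ2 (op n.+2 γ (op n.+3 γ (op n.+1 c (op n δ (op n.+1 δ s)))))) =
  op n μ (op n μ2 (op n.+2 γ (op n.+2 μ2 (op n.+1 c (op n δ (op n.+1 δ s)))))).
Proof.
move=> ws; set r := RHS.
by rewrite -(xch c n.+1 0 γ) -(xch δ n 1 γ) -(compat n) -(mu2E n.+1) //
  -(muA S2 n) (mu2E n (op n μ2 s)) // (dl_mu S2 n) -(xch μ2 n 0 γ).
Qed.

(** Cancels the factor x_1 o y_1, which is allowed because [μ2] is a coalgebra morphism. *)
Lemma gam_gam n s : wide n.+3 s ->
  op n γ (op n.+1 γ s) = op n γ (op n μ2 s).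
Proof.
move=> ws; have := cancel21 S μ2 (dl_mu S2) (ep_mu S2) 1
  (op 0 γ (op 1 γ one)) (op 0 γ (op 0 μ2 one)) _ _ _ n s ws.
rewrite !op_op ?op_one_wide //; apply => // {ws} {}n {}s ws.
by rewrite !op_op ?op_one_wide // gam_gam_conv.
Qed.

(** eps(g(x, y)) = eps(x_1 . g(x_2, y)) = eps(x o y). *)
Lemma ep_gam n s :
  wide n.+2 s ->
  op n ε (op n γ s) =
  op n ε (op n ε s).
Proof.
move=> ws; set r := RHS.
by rewrite -(epl K n s) // -(xch ε n 0 γ) -(ep_mu S n) -(mu2E n) //
  (ep_mu S2 n).
Qed.

(* Multiplied by the coproduct of x_1, both sides of the comultiplicativity of
   Gamma become the coproduct of x o y. *)
Lemma dl_gam_conv1 n s :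
  wide n.+2 s ->
  op n μ (op n.+2 μ (op n.+1 c (op n δ (op n.+1 δ (op n.+1 γ (op n δ s)))))) =
  op n δ (op n μ2 s).
Proof.
move=> ws; set r := RHS.
by rewrite -(dl_mu S n) -(mu2E n) //.
Qed.

Lemma dl_gam_conv2 n s :
  wide n.+2 s ->
  op n μ (op n.+2 μ (op n.+1 c (op n δ (op n.+1 γ (op n.+3 γ (op n.+2 c
    (op n.+1 δ (op n.+2 δ (op n δ s))))))))) =
  op n δ (op n μ2 s).
Proof.
move=> ws; set r := RHS.
by rewrite -(xch δ n 0 δ) (xch δ n 0 γ) (br_r2 br_gam n.+1) -(dlA K n)
  (* [cocom] removes the crossing of two components of x that appears when the braiding slides past
     [γ]. *)
  -(xch δ n 0 c) -(xch δ n 1 γ) (dlA K n) -(cocom n.+1) -(xch γ n.+1 0 μ)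
  -(dlA K n) (xch δ n 1 γ) (xch δ n 0 c)
  -(xch δ n 0 c (op n.+3 γ (op n.+2 c (op n δ (op n δ (op n.+1 δ s))))))
  (xch c n.+1 0 γ) -(xch δ n 1 μ) (dlA K n) -(br_dll K n.+1) -(mu2E n.+2) //
  -(mu2E n) // -(dl_mu S2 n).
Qed.

Lemma dl_gam n s : wide n.+2 s ->
  op n δ (op n γ s) =
  op n γ (op n.+2 γ (op n.+1 c (op n δ (op n.+1 δ s)))).
Proof.
move=> ws; have := cancel12 S 1 (op 0 δ γ)
  (op 0 γ (op 2 γ (op 1 c (op 0 δ (op 1 δ one))))) _ _ _ n s ws.
rewrite !op_op ?op_one_wide //; apply => // {ws} {}n {}s ws.
by rewrite !op_op ?op_one_wide // dl_gam_conv1 // dl_gam_conv2.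
Qed.

(** g(x_1, lam2(x_2)) = lam(x_1) . (x_2 o lam2(x_3)), where the second factor collapses to the
    common unit. *)
Lemma gam_an2 n s :
  wide n.+1 s ->
  op n γ (op n.+1 λ2 (op n δ s)) =
  op n λ s.
Proof.
move=> ws; set r := RHS.
by rewrite (gamE n) (xch δ n 0 λ2) (dlA K n) (anr S2 n.+1) (xch λ n 0 η2)
  (et2E n.+1) // (epr K n) // (mur1 S n) //.
Qed.

End BraceToTriple.

(** * From the triple identities to the brace identities *)

Section TripleToBrace.
Context {M : shift_monoid} {K : coalg M} (S : hopf K).
Implicit Types (n : nat) (s x y : M).
Notation δ := (cdl K).
Notation ε := (cep K).
Notation c := (cbr K).
Notation μ := (hmu S).
Notation η := (het S).
Notation λ := (han S).

Variables (γ μ2 : gen M 2 1) (T λV : gen M 1 1).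
Hypothesis br_gam : nat21 K γ.

Hypothesis cocom : forall n s, op n γ (op n.+1 c (op n δ s)) =
  op n γ (op n.+1 c (op n c (op n δ s))).

Hypothesis gam_mu : forall n s, op n γ (op n.+1 μ s) =
  op n μ (op n γ (op n.+2 γ (op n.+1 c (op n δ s)))).

Hypothesis gam_gam : forall n s, op n γ (op n.+1 γ s) =
  op n γ (op n μ (op n.+1 γ (op n δ s))).

Hypothesis dl_gam : forall n s, op n δ (op n γ s) =
  op n γ (op n.+2 γ (op n.+1 c (op n δ (op n.+1 δ s)))).

Hypothesis ep_gam : forall n s, op n ε (op n γ s) =
  op n ε (op n ε s).

Hypothesis dl_T : forall n s, op n δ (op n T s) =
  op n c (op n.+1 T (op n T (op n δ s))).

Hypothesis ep_T : forall n s, op n ε (op n T s) =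
  op n ε s.

Hypothesis T_mul : forall n s, op n μ (op n.+1 γ (op n δ (op n T s))) =
  op n μ (op n.+1 γ (op n.+1 T (op n T (op n δ s)))).

Hypothesis gam_T : forall n s, op n γ (op n.+1 T (op n δ s)) =
  op n λ s.

Hypothesis gam_TV : forall n s, op n γ (op n T (op n δ s)) =
  op n λV (op n T s).

Hypothesis mu2E : forall n s, op n μ2 s =
  op n μ (op n.+1 γ (op n δ s)).

Hypothesis gam_et : forall n s, wide n.+1 s -> op n γ (op n η s) =
  s.

Hypothesis anVK : forall n s, wide n.+1 s -> op n λ (op n λV s) =
  s.

Hypothesis anKV : forall n s, wide n.+1 s -> op n λV (op n λ s) =
  s.

(* e = gamma(-, 1) is idempotent for the convolution product by [gam_etr_sq],
   and invertible by [gam_etr_an], hence trivial. *)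
Lemma gam_etr_sq n s :
  wide n.+1 s ->
  op n μ (op n γ (op n.+1 η (op n.+1 γ (op n.+2 η (op n δ s))))) =
  op n γ (op n.+1 η s).
Proof.
move=> ws; set r := RHS.
by rewrite -(xch δ n 0 η) (xch η n.+1 0 γ)
  -(br_etr S n.+1 (op n δ (op n.+1 η s))) // -(xch δ n 0 η) -(gam_mu n)
  (mul1 S n.+1) //.
Qed.

(** The unit is grouplike, so e is comultiplicative; hence [λ] after e inverts it for
    convolution. *)
Lemma dl_gam_etr n s :
  wide n.+1 s ->
  op n δ (op n γ (op n.+1 η s)) =
  op n γ (op n.+1 η (op n.+1 γ (op n.+2 η (op n δ s)))).
Proof.
move=> ws; set r := RHS.
by rewrite (dl_gam n) (xch δ n 0 δ) (xch δ n 0 η) (dl_et S n.+2)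
  (br_etr S n.+1) // -(xch η n.+1 0 γ).
Qed.

Lemma gam_etr_an n s :
  wide n.+1 s ->
  op n μ (op n γ (op n.+1 η (op n.+1 λ (op n.+1 γ (op n.+2 η (op n δ s)))))) =
  op n η (op n ε s).
Proof.
move=> ws; set r := RHS.
by rewrite (xch η n.+1 0 λ) (xch γ n 0 λ) -(dl_gam_etr n) // (anr S n)
  (ep_gam n) (xch ε n 0 η) (ep_et S n) //.
Qed.

Lemma gam_etr n s :
  wide n.+1 s ->
  op n γ (op n.+1 η s) =
  op n η (op n ε s).
Proof.
move=> ws; set r := RHS.
by rewrite -(mur1 S n (op n γ (op n.+1 η s))) // -(epr K n s) // -(xch γ n 0 η)
  -(xch η n.+1 0 η) -(gam_etr_an n.+1) // (xch η n.+1 0 μ) (xch γ n 0 μ)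
  -(dlA K n) -(xch δ n 1 η) -(xch δ n 0 γ) -(xch δ n 0 λ) -(muA S n)
  (gam_etr_sq n) // (gam_etr_an n) //.
Qed.

Lemma mu2_etr n s :
  wide n.+1 s ->
  op n μ2 (op n.+1 η s) =
  s.
Proof.
move=> ws; set r := RHS.
by rewrite (mu2E n) (xch δ n 0 η) (gam_etr n.+1) // (epr K n) // (mur1 S n) //.
Qed.

Lemma mu2_etl n s :
  wide n.+1 s ->
  op n μ2 (op n η s) =
  s.
Proof.
move=> ws; set r := RHS.
by rewrite (mu2E n) (dl_et S n) (xch η n 0 η) (gam_et n.+1) // (mul1 S n) //.
Qed.

(** Expands the coproduct of x_1 . g(x_2, y); as in [dl_gam_conv2], [cocom] removes the crossing
    between components of x. *)
Lemma dl_mu2 n s :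
  op n δ (op n μ2 s) =
  op n μ2 (op n.+2 μ2 (op n.+1 c (op n δ (op n.+1 δ s)))).
Proof.
set r := RHS.
by rewrite (mu2E n) (dl_mu S n) (dl_gam n.+1) -(xch δ n 0 δ) (xch δ n 0 γ)
  (br_r2 br_gam n.+1) -(dlA K n) -(xch δ n 0 c) -(xch δ n 1 γ) (dlA K n)
  -(cocom n.+1) -(xch γ n.+1 0 μ) -(dlA K n) (xch δ n 1 γ) (xch δ n 0 c)
  -(xch δ n 0 c (op n.+3 γ (op n.+2 c (op n δ (op n δ (op n.+1 δ s))))))
  (xch c n.+1 0 γ) -(xch δ n 1 μ) (dlA K n) -(br_dll K n.+1) -(mu2E n.+2)
  -(mu2E n).
Qed.

Lemma ep_mu2 n s :
  wide n.+2 s ->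
  op n ε (op n μ2 s) =
  op n ε (op n ε s).
Proof.
move=> ws; set r := RHS.
by rewrite (mu2E n) (ep_mu S n) (xch ε n 0 γ) (ep_gam n) (epl K n) //.
Qed.

(** (x o y) o z = (x_1 o y_1) . g(x_2, g(y_2, z)) = x_1 . g(x_2, y_1 . g(y_2, z)) = x o (y o z), up
    to braidings. *)
Lemma mu2A n s :
  op n μ2 (op n μ2 s) =
  op n μ2 (op n.+1 μ2 s).
Proof.
set r := RHS.
by rewrite (mu2E n (op n μ2 s)) (dl_mu2 n) -(xch μ2 n 0 γ) (mu2E n.+2)
  -(gam_gam n.+2) (mu2E n) -(xch c n.+1 0 γ) -(xch δ n 1 γ)
  (xch δ n 1 γ (op n.+1 c (op n δ (op n.+2 γ (op n.+1 δ s))))) (xch δ n 0 c)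
  (muA S n) (dlA K n) -(gam_mu n.+1) -(xch δ n 0 μ) -(mu2E n.+1) -(mu2E n).
Qed.

Lemma mu2_compat n s :
  op n μ2 (op n.+1 μ s) =
  op n μ (op n μ2 (op n.+2 γ (op n.+1 c (op n δ s)))).
Proof.
set r := RHS.
by rewrite (mu2E n) (xch δ n 0 μ) (gam_mu n.+1) -(muA S n) -(dlA K n)
  -(xch δ n 0 c) -(xch δ n 1 γ) -(mu2E n).
Qed.

Lemma mu2_Tr n s :
  op n μ2 (op n.+1 T (op n δ s)) =
  op n η (op n ε s).
Proof.
set r := RHS.
by rewrite (mu2E n) (xch δ n 0 T) (dlA K n) (gam_T n.+1) (anr S n).
Qed.

(* Composing with the antipode reverses the product T(x_1) . lam^-1(T(x_2)) into
   the product of [anr] at T(x), because T reverses coproducts. *)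
Lemma an_T_anV n s :
  wide n.+1 s ->
  op n λ (op n μ (op n.+1 λV (op n.+1 T (op n T (op n δ s))))) =
  op n λ (op n η (op n ε s)).
Proof.
move=> ws; set r := RHS.
by rewrite (an_mu S n) // -(br_r1 (br_an0 S) n) (anVK n.+1) // -(dl_T n)
  (anr S n) -(an_et S n) // (ep_T n).
Qed.

Lemma T_anV n s :
  wide n.+1 s ->
  op n μ (op n.+1 λV (op n.+1 T (op n T (op n δ s)))) =
  op n η (op n ε s).
Proof.
move=> ws; set r := RHS.
by rewrite -(anKV n (op n μ (op n.+1 λV (op n.+1 T (op n T (op n δ s)))))) //
  (an_T_anV n) // (anKV n) //.
Qed.

(** T(x_1) o x_2 = T(x_1) . g(T(x_2), x_3) by [T_mul], and [gam_TV] makes this T(x_1) .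
    lam^-1(T(x_2)). *)
Lemma mu2_Tl n s :
  wide n.+1 s ->
  op n μ2 (op n T (op n δ s)) =
  op n η (op n ε s).
Proof.
move=> ws; set r := RHS.
by rewrite (mu2E n) (T_mul n) (dlA K n) (xch T n 0 δ) (gam_TV n.+1)
  (T_anV n) //.
Qed.

Lemma gam_mu2E n s :
  wide n.+2 s ->
  op n μ (op n λ (op n.+1 μ2 (op n δ s))) =
  op n γ s.
Proof.
move=> ws; set r := RHS.
by rewrite (mu2E n.+1) (xch λ n 0 μ) -(muA S n) -(dlA K n) -(xch δ n 0 γ)
  (anl S n) (xch ε n 0 γ) (epl K n) // (mul1 S n) //.
Qed.

End TripleToBrace.

Set Implicit Arguments.
Unset Strict Implicit.

(* Lets unification find the flattening of an iterated tensor product. *)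
Canonical flat_unit.
Canonical flat_tens.

(** * The shift monoid of the tensor powers of an object *)

Section CayBraid.
Variable C : strict_braided.
Implicit Types (a b d : flat C).

Definition cayE :=
  (@cay_comp C, @cay_tens C, @cay_asc C, @cay_asc' C, @cay_lun C, @cay_lun' C,
   @cay_run C, @cay_id C, @flm_id C, @comp1m C, @compm1 C).

Lemma cay_braid_nat a b a' b' (f : hom a b) (g : hom a' b') Z :
  cay (braid b b') Z ∘ (cay f (fl b' Z) ∘ flm a (cay g Z)) =
  cay g (fl b Z) ∘ flm a' (cay f Z) ∘ cay (braid a a') Z.
Proof.
have := congr1 (fun h => cay h Z) (braid_nat f g).
by rewrite !cayE.
Qed.

Lemma cay_braid_tensr a b d Z :
  cay (braid a (b ⊗ d)) Z =
  flm b (cay (braid a d) Z) ∘ cay (braid a b) (fl d Z).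
Proof.
have := congr1 (fun h => cay h Z) (braid_tensr a b d).
by rewrite !cayE.
Qed.

Lemma cay_braid_tensl a b d Z :
  cay (braid (a ⊗ b) d) Z =
  cay (braid a d) (fl b Z) ∘ flm a (cay (braid b d) Z).
Proof.
have := congr1 (fun h => cay h Z) (braid_tensl a b d).
by rewrite !cayE.
Qed.

Lemma cay_iso a b (f : hom a b) Z : is_iso f -> is_iso (cay f Z).
Proof.
by case=> g [gf fg]; exists (cay g Z); split; rewrite -cay_comp
  (gf, fg) cay_id.
Qed.

Lemma idem_iso_id (D : category) (a : D) (f : hom a a) :
  is_iso f -> f = f ∘ f -> f = idm a.
Proof. by case=> g [gf _] E; rewrite -gf {2}E compA gf comp1m. Qed.

(* The hexagon makes the braiding with the unit an invertible idempotent. *)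
Lemma cay_braid_unitl a Z : cay (braid tunit a) Z = idm (fl a Z).
Proof.
apply: idem_iso_id; first exact: cay_iso (braid_iso _ _).
have := cay_braid_nat (lun tunit) (idm a) Z.
by rewrite !cayE cay_braid_tensl.
Qed.

Lemma cay_braid_unitr a Z : cay (braid a tunit) Z = idm (fl a Z).
Proof.
apply: idem_iso_id; first exact: cay_iso (braid_iso _ _).
have := cay_braid_nat (idm a) (lun tunit) Z.
by rewrite !cayE cay_braid_tensr.
Qed.

End CayBraid.

Section Model.
Variables (C : strict_braided) (H : C).

Fixpoint pw n : C := if n is n'.+1 then H ⊗ pw n' else tunit.

(* Arrows between tensor powers of H, undefined on too small powers. *)
Definition parr := forall m, option {p : nat & hom (pw m) (pw p)}.

Definition parr_one : parr := fun m => Some (existT _ m (idm (pw m))).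

Definition parr_mul (g f : parr) : parr := fun m =>
  if f m is Some (existT p u) then
    if g p is Some (existT q v) then Some (existT _ q (v ∘ u)) else None
  else None.

Definition parr_sh (f : parr) : parr := fun m =>
  if m is m'.+1 return option {p : nat & hom (pw m) (pw p)} then
    if f m' is Some (existT p u) then Some (existT _ p.+1 (H ◁ u)) else None
  else None.

Definition parr_shift : shift_monoid.
Proof.
refine (@ShiftMonoid parr parr_one parr_mul parr_sh _ _ _ _).
- move=> x y z; apply: functional_extensionality_dep => m; rewrite /parr_mul.
  case: (z m) => // -[p u]; case: (y p) => // -[q v].
  by case: (x q) => // -[r w]; rewrite compA.
- move=> x; apply: functional_extensionality_dep => m; rewrite /parr_mul /=.
  by case: (x m) => // -[p u]; rewrite comp1m.
- move=> x; apply: functional_extensionality_dep => m; rewrite /parr_mul /=.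
  by case: (x m) => // -[p u]; rewrite compm1.
- move=> x y; apply: functional_extensionality_dep => -[|m] //.
  rewrite /parr_mul /=; case: (y m) => //= -[p u].
  by case E: (x p) => [[q v]|] /=; rewrite ?E ?tensr_comp.
Defined.
End Model.

Ltac gen_tac x :=
  apply: functional_extensionality_dep; case=> [|[|m]] //=;
  rewrite /parr_mul /parr_sh /=;
  (case: (x _) => [[p u]|] //=).
Ltac gen_tac0 :=
  apply: functional_extensionality_dep; case=> [|[|m]] //=;
  rewrite /parr_mul /parr_sh /= ?tensm_id ?comp1m //.

(** * Generators given by morphisms of the category *)

Section Generators.
Variables (C : strict_braided) (H : C).
Notation M := (parr_shift H).
Notation pw := (pw H).
(** Lets unification read the section variable as a single letter; the later sections repeat this
    for their own [H]. *)
Canonical flat_base := flat_letter H.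

Definition gen21 (f : hom (H ⊗ H) H) : gen M 2 1.
Proof.
refine (@Gen M 2 1 (fun m => if m is m'.+2
  return option {p : nat & hom (pw m) (pw p)}
  then Some (existT _ m'.+1 (cay f (pw m'))) else None) _ _).
- move=> x; gen_tac x; congr (Some (existT _ _ _)); exact: (cay_nat f u).
- gen_tac0.
Defined.

Definition gen12 (f : hom H (H ⊗ H)) : gen M 1 2.
Proof.
refine (@Gen M 1 2 (fun m => if m is m'.+1
  return option {p : nat & hom (pw m) (pw p)}
  then Some (existT _ m'.+2 (cay f (pw m'))) else None) _ _).
- move=> x; gen_tac x; congr (Some (existT _ _ _)); exact: (cay_nat f u).
- gen_tac0.
Defined.

Definition gen22 (f : hom (H ⊗ H) (H ⊗ H)) : gen M 2 2.
Proof.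
refine (@Gen M 2 2 (fun m => if m is m'.+2
  return option {p : nat & hom (pw m) (pw p)}
  then Some (existT _ m'.+2 (cay f (pw m'))) else None) _ _).
- move=> x; gen_tac x; congr (Some (existT _ _ _)); exact: (cay_nat f u).
- gen_tac0.
Defined.

Definition gen11 (f : hom H H) : gen M 1 1.
Proof.
refine (@Gen M 1 1 (fun m => if m is m'.+1
  return option {p : nat & hom (pw m) (pw p)}
  then Some (existT _ m'.+1 (cay f (pw m'))) else None) _ _).
- move=> x; gen_tac x; congr (Some (existT _ _ _)); exact: (cay_nat f u).
- gen_tac0.
Defined.

Definition gen01 (f : hom tunit H) : gen M 0 1.
Proof.
refine (@Gen M 0 1 (fun m => Some (existT _ m.+1 (cay f (pw m)))) _ _).
- move=> x; gen_tac x; congr (Some (existT _ _ _)); exact: (cay_nat f u).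
- gen_tac0.
Defined.

Definition gen10 (f : hom H tunit) : gen M 1 0.
Proof.
refine (@Gen M 1 0 (fun m => if m is m'.+1
  return option {p : nat & hom (pw m) (pw p)}
  then Some (existT _ m' (cay f (pw m'))) else None) _ _).
- move=> x; gen_tac x; congr (Some (existT _ _ _)); exact: (cay_nat f u).
- gen_tac0.
Defined.

End Generators.

Ltac parr_simpl := rewrite /= /parr_mul /parr_sh /= /parr_one /=.
Ltac parr_ext0 m :=
  apply: functional_extensionality_dep => m; parr_simpl.
Ltac parr_ext1 m :=
  apply: functional_extensionality_dep => -[|m] //; parr_simpl.
Ltac parr_ext2 m :=
  apply: functional_extensionality_dep => -[|[|m]] //; parr_simpl.
Ltac parr_ext3 m :=
  apply: functional_extensionality_dep => -[|[|[|m]]] //; parr_simpl.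
(** Carries an identity [E] between morphisms into the shift monoid by flattening both sides over
    the remaining strands [Z]. *)
Ltac use_cay E Z :=
  rewrite ?tensm_id;
  congr (Some (existT _ _ _));
  have := congr1 (fun h => cay h Z) E;
  rewrite /tens_mu /tens_eta /tens_eps /tens_delta /mid_braid ?cayE /= ?cayE
    ?compA;
  (try by move=> ->); try by move=> <-.

(** The same for an instance [E] of naturality of the braiding that is already flattened; braidings
    with tensor products or the unit are resolved on the way. *)
Ltac use_nat E :=
  rewrite ?tensm_id ?compm1;
  congr (Some (existT _ _ _));
  have := E; rewrite ?cayE ?cay_braid_tensr ?cay_braid_tensl
    ?cay_braid_unitl ?cay_braid_unitr ?cayE /= ?tensm_id ?comp1m ?compm1
      ?compA;
  (try by move=> ->); try by move=> <-.

(** * Interpretation of coalgebras and Hopf algebras as words *)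

Section Coalgebra.
Variables (C : strict_braided) (H : C).
Notation M := (parr_shift H).
Notation pw := (pw H).
Canonical flat_hopf := flat_letter H.
Variables (eps : hom H tunit) (delta : hom H (H ⊗ H)).
Hypothesis coalgP : is_coalgebra eps delta.

Definition coalg_of : coalg M.
Proof.
refine (@Coalg M (gen12 delta) (gen10 eps) (gen22 (braid H H)) _ _ _ _ _ _).
- by case: coalgP => _ _ E; parr_ext1 m; use_cay E (pw m).
- by case: coalgP => _ E _; parr_ext1 m; use_cay E (pw m).
- by case: coalgP => E _ _; parr_ext1 m; use_cay E (pw m).
- by parr_ext2 m; use_nat (cay_braid_nat delta (idm H) (pw m)).
- by parr_ext2 m; use_nat (cay_braid_nat (idm H) delta (pw m)).
- by parr_ext2 m; use_nat (cay_braid_nat (idm H) eps (pw m)).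
Defined.

Lemma nat21_gen (f : hom (H ⊗ H) H) : nat21 coalg_of (gen21 f).
Proof.
split.
- by parr_ext3 m; use_nat (cay_braid_nat f (idm H) (pw m)).
- by parr_ext3 m; use_nat (cay_braid_nat (idm H) f (pw m)).
Qed.

Lemma nat11_gen (f : hom H H) : nat11 coalg_of (gen11 f).
Proof.
split.
- by parr_ext2 m; use_nat (cay_braid_nat f (idm H) (pw m)).
- by parr_ext2 m; use_nat (cay_braid_nat (idm H) f (pw m)).
Qed.

Variables (eta : hom tunit H) (mu : hom (H ⊗ H) H) (lam : hom H H).
Hypothesis hopfP : is_hopf eta mu eps delta lam.

Definition hopf_of : hopf coalg_of.
Proof.
refine (@Hopf M coalg_of (gen21 mu) (gen01 eta) (gen11 lam)
  _ _ _ _ _ _ _ _ _ (nat21_gen mu) _ _ (nat11_gen lam)).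
- by case: hopfP => -[[_ _ E] _ _ _] _ _; parr_ext3 m; use_cay E (pw m).
- by case: hopfP => -[[_ E _] _ _ _] _ _; parr_ext1 m; use_cay E (pw m).
- by case: hopfP => -[[E _ _] _ _ _] _ _; parr_ext1 m; use_cay E (pw m).
- by case: hopfP => -[_ _ _ [_ E]] _ _; parr_ext2 m; use_cay E (pw m).
- by case: hopfP => -[_ _ _ [E _]] _ _; parr_ext0 m; use_cay E (pw m).
- case: hopfP => -[_ _ [_ E] _] _ _; parr_ext2 m.
  (* The word applies the left counit first, the flattened tensor product the right one; naturality
     exchanges them. *)
  by rewrite -(cay_nat eps (cay eps (pw m))); use_cay E (pw m).
- by case: hopfP => -[_ _ [E _] _] _ _; parr_ext0 m; use_cay E (pw m).
- by case: hopfP => _ _ E; parr_ext1 m; use_cay E (pw m).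
- by case: hopfP => _ E _; parr_ext1 m; use_cay E (pw m).
- by parr_ext1 m; use_nat (cay_braid_nat eta (idm H) (pw m)).
- by parr_ext1 m; use_nat (cay_braid_nat (idm H) eta (pw m)).
Defined.
End Coalgebra.

Lemma wide_one (M : shift_monoid) a : wide a (iter a sh (one : M)).
Proof. by rewrite /wide /op -iter_shM mul1m. Qed.

Lemma parr_inj (C : strict_braided) (H : C) a p (u v : hom (pw H a) (pw H p))
    (x y : parr_shift H) :
  x = y -> x a = Some (existT _ p u) -> y a = Some (existT _ p v) -> u = v.
Proof. by move=> -> -> [] e; exact: inj_pair2 e. Qed.

(** The way back: evaluates an identity of words on exactly [a] strands and concludes by
    faithfulness of [cay]. *)
Ltac unshift a E :=
  let e := fresh in
  have e := @parr_inj _ _ a _ _ _ _ _ E erefl erefl;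
  apply: cay_inj; move: e;
  rewrite /tens_mu /tens_eta /tens_eps /tens_delta /mid_braid ?cayE /= ?cayE
    ?tensm_id ?comp1m ?compm1 ?compA.

(** * Identities between morphisms of C *)

Section Brace.
Variables (C : strict_braided) (H : C).
Canonical flat_brace := flat_letter H.
Variables (eps : hom H tunit) (delta : hom H (H ⊗ H)).
Variables S1 S2 : hopf_on eps delta.
(** A variable tied to its formula by [GamE], so that flattening keeps it as one generator; it is
    later instantiated with [erefl]. *)
Variable Gam : hom (H ⊗ H) H.
Hypothesis GamE : Gam = Gamma_of S1 S2.
Hypothesis compatP : mu S2 ∘ (H ◁ mu S1) =
  mu S1 ∘ (mu S2 ⊠ Gam) ∘ mid_braid H H H H ∘ (delta ▷ (H ⊗ H)).
Hypothesis cocommP : cocomm_for delta Gam.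

Lemma hopf_coalg (S : hopf_on eps delta) : is_coalgebra eps delta.
Proof. by case: (hopf_onP S) => -[]. Qed.

Let K := coalg_of (hopf_coalg S1).
Let X1 : hopf K := hopf_of (hopf_coalg S1) (hopf_onP S1).
Let X2 : hopf K := hopf_of (hopf_coalg S1) (hopf_onP S2).
Let γ : gen (parr_shift H) 2 1 := gen21 Gam.

Lemma brace_gamE n s : op n γ s =
  op n (hmu X1) (op n (han X1) (op n.+1 (hmu X2) (op n (cdl K) s))).
Proof.
have E : γ = hmu X1 * han X1 * sh (hmu X2) * cdl K :> parr_shift H.
  by parr_ext2 m; use_cay GamE (pw H m).
by lift E n s.
Qed.

Lemma brace_compat n s : op n (hmu X2) (op n.+1 (hmu X1) s) =
  op n (hmu X1) (op n (hmu X2) (op n.+2 γ (op n.+1 (cbr K) (op n (cdl K) s)))).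
Proof.
have E : hmu X2 * sh (hmu X1) =
    hmu X1 * hmu X2 * sh (sh γ) * sh (cbr K) * cdl K :> parr_shift H.
  by parr_ext3 m; use_cay compatP (pw H m).
by lift E n s.
Qed.

Lemma brace_cocom n s : op n γ (op n.+1 (cbr K) (op n (cdl K) s)) =
  op n γ (op n.+1 (cbr K) (op n (cbr K) (op n (cdl K) s))).
Proof.
have E : γ * sh (cbr K) * cdl K =
    γ * sh (cbr K) * cbr K * cdl K :> parr_shift H.
  by parr_ext2 m; use_cay cocommP (pw H m).
by lift E n s.
Qed.

Let br_γ : nat21 K γ := nat21_gen (hopf_coalg S1) Gam.

Lemma Gamma_action :
  Gam ∘ (H ◁ Gam) ∘ asc H H H = Gam ∘ (mu S2 ▷ H).
Proof.
by unshift 3 (gam_gam X1 X2 γ brace_gamE brace_compat 0 _ (wide_one _ 3)).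
Qed.

Lemma Gamma_mul : mu S2 = mu S1 ∘ (H ◁ Gam) ∘ asc H H H ∘ (delta ▷ H).
Proof.
by unshift 2 (mu2E X1 X2 γ brace_gamE 0 _ (wide_one _ 2)).
Qed.

Lemma Gamma_mu : Gam ∘ (H ◁ mu S1) =
  mu S1 ∘ (Gam ⊠ Gam) ∘ mid_braid H H H H ∘ (delta ▷ (H ⊗ H)).
Proof.
by unshift 3 (gam_mu X1 X2 γ brace_gamE brace_compat 0 _ (wide_one _ 3)).
Qed.

Lemma brace_eta : eta S2 = eta S1.
Proof.
by unshift 0 (et2E X1 X2 γ brace_gamE brace_compat 0 _ (wide_one _ 0)).
Qed.

Lemma Gamma_eta : Gam ∘ (eta S1 ▷ H) = lun H.
Proof.
by unshift 1 (gam_et X1 X2 γ brace_gamE brace_compat 0 _ (wide_one _ 1)).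
Qed.

Lemma Gamma_coalg :
  is_coalg_mor (tens_eps eps eps) (tens_delta delta delta) eps delta Gam.
Proof.
split.
- unshift 2 (ep_gam X1 X2 γ brace_gamE 0 _ (wide_one _ 2)).
  have N : cay eps tunit ∘ (H ◁ cay eps tunit) =
    cay eps tunit ∘ cay eps (H ⊗ tunit) := cay_nat eps _.
  by rewrite N.
- by unshift 2 (dl_gam X1 X2 γ br_γ brace_gamE brace_cocom 0 _ (wide_one _ 2)).
Qed.

Lemma Gamma_lam : Gam ∘ (H ◁ lam S2) ∘ delta = lam S1.
Proof.
by unshift 1 (gam_an2 X1 X2 γ brace_gamE brace_compat 0 _ (wide_one _ 1)).
Qed.

Lemma lam_delta (S : hopf_on eps delta) :
  delta ∘ lam S = braid H H ∘ (lam S ⊠ lam S) ∘ delta.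
Proof.
unshift 1 (dl_an (hopf_of (hopf_coalg S) (hopf_onP S)) 0 _ (wide_one _ 1)).
have N : cay (lam S) (H ⊗ tunit) ∘ (H ◁ cay (lam S) tunit) =
  (H ◁ cay (lam S) tunit) ∘ cay (lam S) (H ⊗ tunit) := cay_nat (lam S) _.
by rewrite -[_ ∘ (H ◁ cay (lam S) tunit) in X in _ -> X]compA N !compA.
Qed.

Lemma lam_eps (S : hopf_on eps delta) : eps ∘ lam S = eps.
Proof.
by unshift 1 (ep_an (hopf_of (hopf_coalg S) (hopf_onP S)) 0 _ (wide_one _ 1)).
Qed.

End Brace.

(** * The second Hopf algebra structure of a brace triple *)

Section Triple.
Variables (C : strict_braided) (H : C).
Canonical flat_triple := flat_letter H.
Variables (eps : hom H tunit) (delta : hom H (H ⊗ H)).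
Variables (S : hopf_on eps delta) (gam : hom (H ⊗ H) H) (T lamV : hom H H).
Hypothesis tripleP : is_brace_triple S gam T.
Hypothesis lamVP : is_inverse (lam S) lamV.
Hypothesis gam_lamV : gam ∘ (T ▷ H) ∘ delta = lamV ∘ T.
Variable mu2 : hom (H ⊗ H) H.
Hypothesis mu2E : mu2 = mu S ∘ (H ◁ gam) ∘ asc H H H ∘ (delta ▷ H).

Let K := coalg_of (hopf_coalg S).
Let X : hopf K := hopf_of (hopf_coalg S) (hopf_onP S).
Let γ : gen (parr_shift H) 2 1 := gen21 gam.
Let μ2 : gen (parr_shift H) 2 1 := gen21 mu2.
Let t : gen (parr_shift H) 1 1 := gen11 T.
Let λV : gen (parr_shift H) 1 1 := gen11 lamV.
Notation δ := (cdl K).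
Notation ε := (cep K).
Notation c := (cbr K).
Notation μ := (hmu X).
Notation η := (het X).
Notation λ := (han X).
Let br_γ : nat21 K γ := nat21_gen (hopf_coalg S) gam.

Lemma triple_cocom n s : op n γ (op n.+1 c (op n δ s)) =
  op n γ (op n.+1 c (op n c (op n δ s))).
Proof.
have E : γ * sh c * δ = γ * sh c * c * δ :> parr_shift H.
  by parr_ext2 m; use_cay (bt_cocomm tripleP) (pw H m).
by lift E n s.
Qed.

Lemma triple_gam_mu n s : op n γ (op n.+1 μ s) =
  op n μ (op n γ (op n.+2 γ (op n.+1 c (op n δ s)))).
Proof.
have E : γ * sh μ = μ * γ * sh (sh γ) * sh c * δ :> parr_shift H.
  by parr_ext3 m; use_cay (bt_gam_mu tripleP) (pw H m).
by lift E n s.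
Qed.

Lemma triple_gam_gam n s : op n γ (op n.+1 γ s) =
  op n γ (op n μ (op n.+1 γ (op n δ s))).
Proof.
have E : γ * sh γ = γ * μ * sh γ * δ :> parr_shift H.
  by parr_ext3 m; use_cay (bt_gam_gam tripleP) (pw H m).
by lift E n s.
Qed.

Lemma triple_dl_gam n s : op n δ (op n γ s) =
  op n γ (op n.+2 γ (op n.+1 c (op n δ (op n.+1 δ s)))).
Proof.
have E : δ * γ = γ * sh (sh γ) * sh c * δ * sh δ :> parr_shift H.
  by parr_ext2 m; use_cay (proj2 (bt_gam_coalg tripleP)) (pw H m).
by lift E n s.
Qed.

Lemma triple_ep_gam n s : op n ε (op n γ s) = op n ε (op n ε s).
Proof.
have E : ε * γ = ε * ε :> parr_shift H.
  parr_ext2 m; rewrite -(cay_nat eps (cay eps (pw H m))).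
  by use_cay (proj1 (bt_gam_coalg tripleP)) (pw H m).
by lift E n s.
Qed.

Lemma triple_dl_T n s : op n δ (op n t s) =
  op n c (op n.+1 t (op n t (op n δ s))).
Proof.
have E : δ * t = c * sh t * t * δ :> parr_shift H.
  parr_ext1 m; rewrite -[_ ∘ cay T (H ⊗ pw H m)]compA.
  rewrite -(cay_nat T (cay T (pw H m))).
  by use_cay (bt_T_delta tripleP) (pw H m).
by lift E n s.
Qed.

Lemma triple_ep_T n s : op n ε (op n t s) = op n ε s.
Proof.
have E : ε * t = ε :> parr_shift H.
  by parr_ext1 m; use_cay (bt_T_eps tripleP) (pw H m).
by lift E n s.
Qed.

Lemma triple_T_mul n s : op n μ (op n.+1 γ (op n δ (op n t s))) =
  op n μ (op n.+1 γ (op n.+1 t (op n t (op n δ s)))).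
Proof.
have E : μ * sh γ * δ * t = μ * sh γ * sh t * t * δ :> parr_shift H.
  parr_ext2 m; rewrite -[_ ∘ (H ◁ cay T _) ∘ _]compA.
  have N : cay T (H ⊗ (H ⊗ pw H m)) ∘ (H ◁ cay T (H ⊗ pw H m)) =
    (H ◁ cay T (H ⊗ pw H m)) ∘ cay T (H ⊗ (H ⊗ pw H m)) := cay_nat T _.
  by rewrite -N; use_cay (bt_T_mul tripleP) (pw H m).
by lift E n s.
Qed.

Lemma triple_gam_T n s : op n γ (op n.+1 t (op n δ s)) = op n λ s.
Proof.
have E : γ * sh t * δ = λ :> parr_shift H.
  by parr_ext1 m; use_cay (bt_gam_T tripleP) (pw H m).
by lift E n s.
Qed.

Lemma triple_gam_TV n s : op n γ (op n t (op n δ s)) = op n λV (op n t s).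
Proof.
have E : γ * t * δ = λV * t :> parr_shift H.
  by parr_ext1 m; use_cay gam_lamV (pw H m).
by lift E n s.
Qed.

Lemma triple_mu2E n s : op n μ2 s = op n μ (op n.+1 γ (op n δ s)).
Proof.
have E : μ2 = μ * sh γ * δ :> parr_shift H.
  by parr_ext2 m; use_cay mu2E (pw H m).
by lift E n s.
Qed.

Lemma triple_gam_et n s : wide n.+1 s -> op n γ (op n η s) = s.
Proof.
have E : γ * η = sh one :> parr_shift H.
  by parr_ext1 m; use_cay (bt_gam_eta tripleP) (pw H m).
by lift E n s => ->.
Qed.

Lemma triple_anVK n s : wide n.+1 s -> op n λ (op n λV s) = s.
Proof.
have E : λ * λV = sh one :> parr_shift H.
  by parr_ext1 m; use_cay (proj2 lamVP) (pw H m).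
by lift E n s => ->.
Qed.

Lemma triple_anKV n s : wide n.+1 s -> op n λV (op n λ s) = s.
Proof.
have E : λV * λ = sh one :> parr_shift H.
  by parr_ext1 m; use_cay (proj1 lamVP) (pw H m).
by lift E n s => ->.
Qed.

Lemma triple_hopf : is_hopf (eta S) mu2 eps delta T.
Proof.
have cP := hopf_coalg S.
case: (hopf_onP S) => -[_ _ [eps_eta _] [delta_eta _]] _ _.
(* The coalgebra axioms and the two conditions on the unit are inherited from [S]. *)
split; first split=> //; first split; try split=> //.
- by unshift 1 (mu2_etr X γ μ2 triple_gam_mu triple_dl_gam triple_ep_gam
    triple_mu2E
    0 _ (wide_one _ 1)).
- by unshift 1 (mu2_etl X γ μ2 triple_mu2E triple_gam_et 0 _ (wide_one _ 1)).
- by unshift 3 (esym (mu2A X γ μ2 br_γ triple_cocom triple_gam_mu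
    triple_gam_gam triple_dl_gam
    triple_mu2E 0 (iter 3 sh one))).
- unshift 2 (ep_mu2 X γ μ2 triple_ep_gam triple_mu2E 0 _ (wide_one _ 2)).
  have N : cay eps tunit ∘ (H ◁ cay eps tunit) =
    cay eps tunit ∘ cay eps (H ⊗ tunit) := cay_nat eps _.
  by rewrite N.
- by unshift 2 (dl_mu2 X γ μ2 br_γ triple_cocom triple_dl_gam triple_mu2E
    0 (iter 2 sh one)).
- by unshift 1 (mu2_Tr X γ μ2 t triple_gam_T triple_mu2E 0 (iter 1 sh one)).
- by unshift 1 (mu2_Tl X γ μ2 t λV triple_dl_T triple_ep_T triple_T_mul
    triple_gam_TV triple_mu2E
    triple_anVK triple_anKV 0 _ (wide_one _ 1)).
Qed.

Lemma triple_compat : mu2 ∘ (H ◁ mu S) =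
  mu S ∘ (mu2 ⊠ gam) ∘ mid_braid H H H H ∘ (delta ▷ (H ⊗ H)).
Proof.
by unshift 3 (mu2_compat X γ μ2 triple_gam_mu triple_mu2E 0 (iter 3 sh one)).
Qed.

Lemma triple_Gamma :
  mu S ∘ (lam S ⊠ mu2) ∘ asc H H H ∘ (delta ▷ H) = gam.
Proof.
by unshift 2 (gam_mu2E X γ μ2 triple_mu2E 0 _ (wide_one _ 2)).
Qed.
End Triple.

(** * Convolution between different objects, and preservation of antipodes *)

Section Convolution.
Variables (C : strict_braided) (D A : C).
Variables (eps : hom D tunit) (delta : hom D (D ⊗ D)).
Variables (eta : hom tunit A) (mu : hom (A ⊗ A) A).
Hypothesis coalgP : is_coalgebra eps delta.
Hypothesis algP : is_algebra eta mu.

(** Treated directly in the category, since the shift monoid only knows the powers of one object. *)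
Definition conv (f g : hom D A) : hom D A := mu ∘ (f ⊠ g) ∘ delta.

Lemma convA f g h : conv (conv f g) h = conv f (conv g h).
Proof.
case: coalgP algP => _ _ deltaA [_ _ muA]; rewrite /conv.
have -> : (mu ∘ (f ⊠ g) ∘ delta) ⊠ h =
    (mu ▷ A) ∘ ((f ⊠ g) ⊠ h) ∘ (delta ▷ D).
  by rewrite -!tensm_comp !comp1m compm1.
have -> : f ⊠ (mu ∘ (g ⊠ h) ∘ delta) =
    (A ◁ mu) ∘ (f ⊠ (g ⊠ h)) ∘ (D ◁ delta).
  by rewrite -!tensm_comp !comp1m compm1.
rewrite !compA -muA -[_ ∘ asc A A A ∘ _]compA asc_nat !compA.
by rewrite -[in LHS]compA -[in LHS]compA [in LHS](compA
  (asc D D D)) deltaA !compA.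
Qed.

Lemma conv1f f : conv (eta ∘ eps) f = f.
Proof.
case: coalgP algP => _ epsl _ [_ etal _]; rewrite /conv.
have -> : (eta ∘ eps) ⊠ f = (eta ▷ A) ∘ (tunit ◁ f) ∘ (eps ▷ D).
  by rewrite -!tensm_comp !comp1m !compm1.
by rewrite !compA etal [lun A ∘ _]tens1m -!compA [lun D ∘ _]compA epsl compm1.
Qed.

Lemma convf1 f : conv f (eta ∘ eps) = f.
Proof.
case: coalgP algP => epsr _ _ [etar _ _]; rewrite /conv.
have -> : f ⊠ (eta ∘ eps) = (A ◁ eta) ∘ (f ▷ tunit) ∘ (D ◁ eps).
  by rewrite -!tensm_comp !comp1m !compm1.
by rewrite !compA etar [run A ∘ _]tensm1 -!compA [run D ∘ _]compA epsr compm1.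
Qed.

End Convolution.

(** The two sides are a right and a left convolution inverse of [f], hence equal by
    associativity. *)
Lemma hopf_mor_lam (C : strict_braided)
    (H : C) epsH deltaH (SH : @hopf_on C H epsH deltaH)
    (B : C) epsB deltaB (SB : @hopf_on C B epsB deltaB) (f : hom H B) :
  is_hopf_mor SH SB f -> f ∘ lam SH = lam SB ∘ f.
Proof.
move=> [[f_eta f_mu] [f_eps f_delta]].
have cP := hopf_coalg SH.
have aP : is_algebra (eta SB) (mu SB) by case: (hopf_onP SB) => -[].
case: (hopf_onP SH) (hopf_onP SB) => _ lamr _ [_ _ laml].
rewrite -[LHS](conv1f cP aP) -[RHS](convf1 cP aP).
have E : conv deltaH (mu SB) (lam SB ∘ f) f = eta SB ∘ epsH.
  rewrite /conv -[f in _ ⊠ f]comp1m tensm_comp compA -compA -f_delta compA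
    laml.
  by rewrite -compA f_eps.
rewrite -{1}E (convA cP aP); congr (conv _ _ _ _).
rewrite /conv -{1}[f]compm1 tensm_comp compA -f_mu -compA -[_ ∘ (_ ∘ _)]compA.
by rewrite [mu SH ∘ _]compA lamr compA f_eta.
Qed.

(** The object maps agree only propositionally, so the actions on arrows are compared up to
    [eq_hom], which becomes an identity once the object maps are identified. *)
Lemma functor_eq (C D : category) (F G : functor C D)
    (e : forall a, fob F a = fob G a) :
  (forall a b (f : hom a b), eq_hom (e b) ∘ fmor F f = fmor G f ∘ eq_hom
    (e a)) ->
  F = G.
Proof.
case: F G e => [fo fm fi fc] [go gm gi gc] /= e.
have eo : fo = go by apply: functional_extensionality_dep.
case: _ / eo gm gi gc e => gm gi gc e E.
have em : fm = gm.
  apply: functional_extensionality_dep => a.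
  apply: functional_extensionality_dep => b.
  apply: functional_extensionality_dep => f.
  by have := E a b f; rewrite !eq_hom_idm comp1m compm1.
by case: _ / em gi gc E => gi gc _; congr Functor; apply: proof_irrelevance.
Qed.

Lemma hopf_on_eq (C : strict_braided) (H : C) eps delta
    (S S' : @hopf_on C H eps delta) :
  eta S = eta S' -> mu S = mu S' -> lam S = lam S' -> S = S'.
Proof.
case: S S' => [e m l p] [e' m' l' p'] /= ee em el.
by subst; rewrite (proof_irrelevance _ p p').
Qed.

(** * The two functors *)

Section Functors.
Variable C : strict_braided.

Lemma s_brace_triple (X : hopf_brace C) : is_s_hopf_brace X ->
  is_brace_triple (hb_1 X) (Gamma_of (hb_1 X) (hb_2 X)) (lam (hb_2 X)).
Proof.
case=> cocom iso1 iso2 lam_mul lam_inv; have compat := hb_compat X.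
split=> //.
- exact: (Gamma_coalg erefl).
- exact: (Gamma_mu erefl).
- by rewrite (Gamma_action erefl) // -(Gamma_mul erefl).
- exact: (Gamma_eta erefl).
- exact: lam_delta.
- exact: lam_eps.
- exact: (Gamma_lam erefl).
Qed.

Definition triple_of_brace (X : sHBr C) : brace_triple C :=
  BraceTriple (s_brace_triple (svalP X)).

(** The action involves the first antipode, which [f] preserves by [hopf_mor_lam]. *)
Lemma triple_of_brace_mor (X Y : hopf_brace C) (f : hom (hb_ob X) (hb_ob Y)) :
  is_hopf_brace_mor f ->
  is_hopf_mor (hb_1 X) (hb_1 Y) f /\
  f ∘ Gamma_of (hb_1 X) (hb_2 X) = Gamma_of (hb_1 Y) (hb_2 Y) ∘ (f ⊠ f).
Proof.
move=> [f1 f2]; split=> //; have f_lam := hopf_mor_lam f1.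
case: f1 f2 => [[_ f_mu1] [_ f_delta]] [[_ f_mu2] _].
rewrite /Gamma_of !compA f_mu1 -[_ ∘ (f ⊠ f) ∘
  (_ ⊠ _)]compA -tensm_comp f_lam f_mu2.
rewrite tensm_comp compA -[_ ∘ (_ ⊠ (_ ⊠ _)) ∘ asc _ _ _]compA -asc_nat !compA.
by rewrite -!compA; do 2!congr
  (_ ∘ _); rewrite -!tensm_comp f_delta comp1m compm1.
Qed.

Definition brace_to_triple : functor (sHBr C) (BT C).
Proof.
refine (@Functor (sHBr C) (BT C) triple_of_brace
  (fun X Y f => exist _ (sval f) (triple_of_brace_mor (svalP f))) _ _).
- by move=> X; apply: sig_inj.
- by move=> X Y Z g f; apply: sig_inj.
Defined.

Definition mul_of_triple (Y : brace_triple C) :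
    hom (bt_ob Y ⊗ bt_ob Y) (bt_ob Y) :=
  mu (bt_hopf Y) ∘ (bt_ob Y ◁ bt_gam Y) ∘ asc _ _ _ ∘ (bt_delta Y ▷ bt_ob Y).

Lemma hopf_of_tripleP (Y : brace_triple C) :
  is_hopf (eta (bt_hopf Y)) (mul_of_triple Y) (bt_eps Y) (bt_delta Y) (bt_T Y).
Proof.
have [lamV lamVP TV] := bt_gam_T_inv (brace_tripleP Y).
exact: (triple_hopf (brace_tripleP Y) lamVP TV erefl).
Qed.

Definition hopf_of_triple (Y : brace_triple C) := HopfOn (hopf_of_tripleP Y).

Lemma Gamma_of_triple (Y : brace_triple C) :
  Gamma_of (bt_hopf Y) (hopf_of_triple Y) = bt_gam Y.
Proof. exact: triple_Gamma. Qed.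

Lemma brace_of_tripleP (Y : brace_triple C) :
  mu (hopf_of_triple Y) ∘ (bt_ob Y ◁ mu (bt_hopf Y)) =
  mu (bt_hopf Y)
  ∘ (mu (hopf_of_triple Y) ⊠ Gamma_of (bt_hopf Y) (hopf_of_triple Y))
  ∘ mid_braid _ _ _ _ ∘ (bt_delta Y ▷ (bt_ob Y ⊗ bt_ob Y)).
Proof.
rewrite Gamma_of_triple; exact: (triple_compat (brace_tripleP Y)).
Qed.

Definition brace_of_triple (Y : brace_triple C) : hopf_brace C :=
  HopfBrace (brace_of_tripleP Y).

Lemma brace_of_triple_s (Y : brace_triple C) :
  is_s_hopf_brace (brace_of_triple Y).
Proof.
have tP := brace_tripleP Y.
split; rewrite /= ?Gamma_of_triple; first exact: bt_cocomm tP.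
- exact: bt_lam_iso tP.
- exact: bt_T_iso tP.
- exact: bt_T_mul tP.
- exact: bt_gam_T_inv tP.
Qed.

Lemma brace_of_triple_mor (X Y : brace_triple C)
    (f : hom (bt_ob X) (bt_ob Y)) :
  is_brace_triple_mor f ->
  is_hopf_brace_mor (X := brace_of_triple X) (Y := brace_of_triple Y) f.
Proof.
move=> [f1 f_gam]; split=> //; case: f1 => [[f_eta f_mu] [f_eps f_delta]].
split; split=> //=; rewrite /mul_of_triple !compA f_mu.
rewrite -[_ ∘ (f ⊠ f) ∘ (_ ◁ _)]compA -tensm_comp compm1 f_gam.
rewrite -[f in f ⊠ (_ ∘ _)]comp1m tensm_comp compA.
rewrite -[_ ∘ (_ ⊠ (_ ⊠ _)) ∘ asc _ _ _]compA -asc_nat !compA.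
by rewrite -!compA; do 3!congr
  (_ ∘ _); rewrite -!tensm_comp f_delta comp1m compm1.
Qed.

Definition triple_to_brace : functor (BT C) (sHBr C).
Proof.
refine (@Functor (BT C) (sHBr C)
  (fun Y => exist _ (brace_of_triple Y) (brace_of_triple_s Y))
  (fun X Y f => exist _ (sval f) (brace_of_triple_mor (svalP f))) _ _).
- by move=> X; apply: sig_inj.
- by move=> X Y Z g f; apply: sig_inj.
Defined.

Lemma hopf_brace_eq (H : C) eps delta
  (S1 S2 S2' : @hopf_on C H eps delta) p p' :
  S2 = S2' -> @HopfBrace C H eps delta S1 S2 p = @HopfBrace C H eps delta S1
    S2' p'.
Proof. by move=> e; subst; rewrite (proof_irrelevance _ p p'). Qed.

(** The first structure and the second antipode return unchanged; the second unit and product do so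
    by [brace_eta] and [Gamma_mul]. *)
Lemma brace_triple_brace (X : sHBr C) :
  triple_to_brace (brace_to_triple X) = X.
Proof.
apply: sig_inj; case: X => -[H eps delta S1 S2 compat] [] /= cocom ? ? ? ?.
apply: hopf_brace_eq; apply: hopf_on_eq => //=.
- exact: esym (brace_eta erefl compat).
- exact: esym (Gamma_mul erefl).
Qed.

Lemma triple_brace_triple (Y : BT C) :
  brace_to_triple (triple_to_brace Y) = Y.
Proof.
rewrite /brace_to_triple /= /triple_of_brace /=.
(* The proof component mentions the action, so it is generalised before the action is rewritten. *)
move: (s_brace_triple _) => /=; rewrite Gamma_of_triple.
case: Y => H eps delta S gam T tP p.
by rewrite (proof_irrelevance _ p tP).
Qed.

(** The round trip keeps the underlying object by conversion, so [e] induces there an equality of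
    that object with itself. *)
Lemma eq_hom_sHBr (X : sHBr C)
    (e : triple_to_brace (brace_to_triple X) = X) :
  sval (eq_hom e) = idm (hb_ob (sval X)).
Proof.
have sval_eq_hom (Y Z : sHBr C) (e' : Y = Z) : sval (eq_hom e') =
    eq_hom (f_equal (fun X : sHBr C => hb_ob (sval X)) e') by destruct e'.
rewrite sval_eq_hom; exact: eq_hom_idm.
Qed.

Lemma eq_hom_BT (Y : BT C) (e : brace_to_triple (triple_to_brace Y) = Y) :
  sval (eq_hom e) = idm (bt_ob Y).
Proof.
have sval_eq_hom (X Z : BT C) (e' : X = Z) : sval (eq_hom e') =
    eq_hom (f_equal (@bt_ob C) e') by destruct e'.
rewrite sval_eq_hom; exact: eq_hom_idm.
Qed.

End Functors.

Theorem theorem2p18 (C : strict_braided) : isomorphic_categories (sHBr C)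
  (BT C).
Proof.
exists (brace_to_triple C), (triple_to_brace C); split.
- apply: (@functor_eq _ _ (functor_comp (triple_to_brace C)
  (brace_to_triple C))
    (functor_id _) (@brace_triple_brace C)) => X Y f; apply: sig_inj.
  (* Both functors keep the underlying morphism, so only the two retyped identities have to be
     removed. *)
  apply: etrans (congr1 (comp^~ (sval f)) (eq_hom_sHBr _)) _.
  apply: etrans (esym (congr1 (comp (sval f)) (eq_hom_sHBr _))).
  by rewrite comp1m compm1.
- apply: (@functor_eq _ _ (functor_comp (brace_to_triple C)
  (triple_to_brace C))
    (functor_id _) (@triple_brace_triple C)) => X Y f; apply: sig_inj.
  apply: etrans (congr1 (comp^~ (sval f)) (eq_hom_BT _)) _.
  apply: etrans (esym (congr1 (comp (sval f)) (eq_hom_BT _))).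
  by rewrite comp1m compm1.
Qed.
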